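(* Let $d\ge 2$ and let $\|\cdot\|_D$ be a $D$-norm on $\mathbb{R}^d$ which has partial derivatives of order $d$ on $(-\infty,0)^d$. Let $C$ be a copula on $\mathbb{R}^d$ such that (i) $C(\boldsymbol{u}) = 1-\|\boldsymbol{1}-\boldsymbol{u}\|_D + o(\|\boldsymbol{1}-\boldsymbol{u}\|)$ as $\boldsymbol{u}\to\boldsymbol{1}$, uniformly for $\boldsymbol{u}\in[0,1]^d$; and (ii) for each nonempty set of distinct indices $\{i_1,\dots,i_k\}\subseteq\{1,\dots,d\}$ and all $\boldsymbol{x}<\boldsymbol{0}$ in $\mathbb{R}^d$, $$\frac{\partial^k}{\partial x_{i_1}\cdots\partial x_{i_k}}\, n\left(C\left(\boldsymbol{1}+\frac{\boldsymbol{x}}{n}\right)-1\right)\longrightarrow \frac{\partial^k}{\partial x_{i_1}\cdots\partial x_{i_k}}\bigl(-\|\boldsymbol{x}\|_D\bigr)\qquad (n\to\infty),$$ where the partial derivatives on the left-hand side are understood to exist for all sufficiently large $n$. Let $\boldsymbol{U}^{(1)},\boldsymbol{U}^{(2)},\dots$ be independent random vectors with distribution function $C$, and let $\boldsymbol{M}^{(n)}=\left(\max_{1\le i\le n}U_1^{(i)},\dots,\max_{1\le i\le n}U_d^{(i)}\right)$. Let $G$ be the probability distribution on $\mathbb{R}^d$ with distribution function $G(\boldsymbol{x})=\exp(-\|\boldsymbol{x}\|_D)$, $\boldsymbol{x}\le\boldsymbol{0}$. Then $$\sup_{A\in\mathbb{B}^d}\left|P\left(n\left(\boldsymbol{M}^{(n)}-\boldsymbol{1}\right)\in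 A\right)-G(A)\right|\longrightarrow 0\qquad (n\to\infty),$$ where $\mathbb{B}^d$ is the Borel $\sigma$-field of $\mathbb{R}^d$.
   Context: All operations and inequalities between vectors are componentwise; $\boldsymbol{0}=(0,\dots,0)$, $\boldsymbol{1}=(1,\dots,1)$. A norm $\|\cdot\|_D$ on $\mathbb{R}^d$ is a $D$-norm if there is a random vector $\boldsymbol{Z}=(Z_1,\dots,Z_d)$ with $Z_i\ge 0$ and $E(Z_i)=1$ for $1\le i\le d$ such that $\|\boldsymbol{x}\|_D=E\left(\max_{1\le i\le d}|x_i|Z_i\right)$ for all $\boldsymbol{x}\in\mathbb{R}^d$. For every $D$-norm, $\boldsymbol{x}\mapsto\exp(-\|\boldsymbol{x}\|_D)$, $\boldsymbol{x}\le\boldsymbol{0}$, defines a distribution function concentrated on $(-\infty,0]^d$ (the standard multivariate max-stable distribution function), with standard negative exponential margins. The same letter denotes a probability measure and its distribution function. A copula on $\mathbb{R}^d$ is the distribution function of a random vector whose components are each uniformly distributed on $[0,1]$. In (i), $\|\cdot\|$ is an arbitrary norm on $\mathbb{R}^d$. *)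

(* Defs.v *)
From HB Require Import structures.
From mathcomp Require Import all_boot all_order all_algebra finmap.
From mathcomp Require Import all_classical all_reals all_analysis.
Set Implicit Arguments.
Unset Strict Implicit.
Unset Printing Implicit Defensive.
Import Order.TTheory GRing.Theory Num.Theory.
Import numFieldNormedType.Exports.
Local Open Scope classical_set_scope.
Local Open Scope ring_scope.

Notation borelRV R d := (g_sigma_algebraType (@open 'rV[R]_d)).

Section Vectors.
Context {R : realType} {d : nat}.
Implicit Types (x y v : 'rV[R]_d) (f : 'rV[R]_d -> R) (s : seq 'I_d).

Definition vlt x y : Prop := forall i, x 0 i < y 0 i.
Definition vle x y : Prop := forall i, x 0 i <= y 0 i.

Definition unit_cube : set 'rV[R]_d :=
  [set u | vle (const_mx 0) u /\ vle u (const_mx 1)].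

Definition is_norm f : Prop :=
  [/\ forall x y, f (x + y) <= f x + f y,
      forall (a : R) x, f (a *: x) = `|a| * f x
    & forall x, f x = 0 -> x = 0].

Definition dir (i : 'I_d) : 'rV[R]_d := delta_mx 0 i.

(* [partial [:: i1; ...; ik] f] is d^k f / dx_i1 ... dx_ik: the derivative with
   respect to x_ik is taken first, the one with respect to x_i1 last. *)
Fixpoint partial s f : 'rV[R]_d -> R :=
  if s is i :: s' then fun x => 'D_(dir i) (partial s' f) x else f.

(* ['D_v] is a total operator, so existence of the outer derivative only makes
   sense once the inner ones exist at the points of the line through [x] in
   direction [i] that are close to [x]. *)
Fixpoint has_partial s f x : Prop :=
  if s is i :: s' then
    (\forall t \near (0 : R), has_partial s' f (x + t *: dir i)) /\
    derivable (partial s' f) x (dir i)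
  else True.

Definition is_df dT (T : measurableType dT) (P : probability T R)
    (X : {RV P >-> borelRV R d}) f : Prop :=
  forall x, P [set t | vle (X t) x] = (f x)%:E.

Definition is_copula f : Prop :=
  exists (dT : measure_display) (T : measurableType dT) (P : probability T R)
         (X : {RV P >-> borelRV R d}),
    is_df X f /\
    forall (i : 'I_d) (A : set R), measurable A ->
      P [set t | A ((X t : 'rV[R]_d) 0 i)] = uniform_prob (@ltr01 R) A.

Definition is_Dnorm f : Prop :=
  is_norm f /\
  exists (dT : measure_display) (T : measurableType dT) (P : probability T R)
         (Z : {RV P >-> borelRV R d}),
    [/\ forall t, vle (const_mx 0) (Z t),
        forall i, ('E_P[fun t => ((Z t : 'rV[R]_d) 0 i)%R] = 1)%E
      & forall x, ((f x)%:E =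
          'E_P[fun t => (\big[Num.max/0]_(i < d)
                          (`|x 0 i| * (Z t : 'rV[R]_d) 0 i))%R])%E].

End Vectors.

Definition mutually_independent (R : realType) dT (T : measurableType dT)
    dE (E : measurableType dE) (P : probability T R) (I : choiceType)
    (X : I -> {RV P >-> E}) : Prop :=
  forall (J : {fset I}) (A : I -> set E),
    (forall i, i \in J -> measurable (A i)) ->
    P (\bigcap_(i in [set` J]) (X i @^-1` A i)) =
    (\prod_(i <- J) P (X i @^-1` A i))%E.

(* [cmax U n] is the componentwise maximum of U 0, ..., U (n - 1) for n >= 1;
   taking U 0 as the default value makes it the true maximum even where the
   components are negative. *)
Definition cmax (R : realType) (d : nat) (U : nat -> 'rV[R]_d) (n : nat) :
    'rV[R]_d :=
  \row_(j < d) \big[Num.max/U 0%N 0 j]_(i < n) U i 0 j.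

(* Main.v *)
Require Import Defs.
From HB Require Import structures.
From mathcomp Require Import all_boot all_order all_algebra finmap.
From mathcomp Require Import all_classical all_reals all_analysis.
From mathcomp Require Import measurable_realfun lra ring.
Set Implicit Arguments.
Unset Strict Implicit.
Unset Printing Implicit Defensive.
Import Order.TTheory GRing.Theory Num.Theory.
Import numFieldNormedType.Exports.
Local Open Scope classical_set_scope.
Local Open Scope ring_scope.

(* The proof is Scheffe's argument, run without assuming that the laws [mu_n] of
   the normalised maxima have densities.  For a finite measure [mu] on R^d let
   [density mu] be the iterated lower limit of the quotients
   mu(]x, x + h]) / (h_1 ... h_d).  It equals the mixed partial derivative
   d_1 ... d_d F(x) of the distribution function F wherever that derivative
   exists, and Fatou and Tonelli give mu(A) >= \int_A density mu for every Borel
   set A; a singular part of [mu] only makes this inequality strict.  For G the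
   inequality is an equality: its mixed derivative exists everywhere on the open
   negative orthant, and an everywhere differentiable function is the integral of
   its derivative, which is applied one coordinate at a time.
   Put m_n = min (density mu_n) (density G).  Both mu_n(A) and G(A) lie between
   \int_A m_n and 1 - \int_{~A} m_n, so |mu_n(A) - G(A)| <= 1 - \int m_n for all
   A at once, and \int m_n -> 1 by Fatou as soon as the mixed derivatives of F_n
   converge pointwise to that of G.  The latter follows from (i), (ii) and the
   Faa di Bruno expansion of F_n(x) = (1 + c_n(x) / n)^n with
   c_n(x) = n (C(1 + x / n) - 1). *)

(** * Measurability of vector-valued maps for the Borel sigma-field of R^d *)

Section Borel.
Context {R : realType} {d : nat}.
Local Notation V := 'rV[R]_d.

(** An open set is the union of the cubes [W c] with rational centre and radius [1 / (k + 1)] that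
    it contains. There are countably many of them, and the preimage of each is a finite intersection
    of conditions on single coordinates. *)
Lemma measurable_rV dT (T : measurableType dT) (f : T -> borelRV R d) :
  (forall i, measurable_fun setT (fun t => (f t : V) 0 i)) ->
  measurable_fun setT f.
Proof.
move=> mf; apply: (@measurability _ _ T (borelRV R d) setT f (@open V)) => // _ [A oA <-].
pose W (c : 'rV[rat]_d * nat) : set V :=
  [set x | forall i, `|ratr (c.1 0 i) - x 0 i| < c.2.+1%:R^-1].
have -> : [set: T] `&` f @^-1` A =
    \bigcup_(c : 'rV[rat]_d * nat) [set t | W c `<=` A /\ W c (f t)].
  rewrite setTI; apply/seteqP; split=> [t At|t [c _ [+ +]]]; last exact.
  move: oA; rewrite openE => /(_ _ At) /nbhs_ballP[e e0 eA].
  (* Half of [e], because both the point [f t] and an arbitrary point of the cube are compared with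
     the rational centre. *)
  have [k ke] : exists k : nat, k.+1%:R^-1 < e / 2.
    have e20 : 0 < e / 2 by rewrite divr_gt0.
    by have [k _ /(_ k (leqnn k))] := near_infty_natSinv_lt (PosNum e20); exists k.
  have /choice[q qP] : forall i : 'I_d, exists q : rat,
      `|ratr q - (f t : V) 0 i| < k.+1%:R^-1.
    move=> i.
    have [|q] := @rat_in_itvoo R ((f t : V) 0 i - k.+1%:R^-1) ((f t : V) 0 i + k.+1%:R^-1).
      by rewrite ltrD2l gtrN// invr_gt0.
    by rewrite in_itv/= => /andP[q1 q2]; exists q; rewrite ltr_distl q1 q2.
  exists (\row_i q i, k) => //; split=> [x /= Wx|i /=]; last by rewrite mxE.
  apply: eA; split => // i j; rewrite ord1 /ball/=.
  have := Wx j; rewrite mxE => qx; have qf := qP j.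
  rewrite (le_lt_trans (ler_distD (ratr (q j)) _ _))//.
  by rewrite [ltRHS]splitr ltrD//; [rewrite distrC|]; exact: lt_trans ke.
apply: countable_bigcupT_measurable => [//|c].
have [WA|WA] := pselect (W c `<=` A); last first.
  by rewrite (_ : mkset _ = set0)//; apply/seteqP; split=> // t [].
rewrite (_ : mkset _ = \bigcap_(i : 'I_d) (fun t => (f t : V) 0 i) @^-1`
    [set y | `|ratr (c.1 0 i) - y| < c.2.+1%:R^-1]).
  apply: fin_bigcap_measurable; first exact: finite_finset.
  move=> i _; rewrite -[X in measurable X]setTI; apply: mf => //.
  exact: measurable_ball.
by apply/seteqP; split=> [t [_ Wt] i _|t Wt]; [exact: Wt|split=> // i; exact: Wt].
Qed.

Lemma measurable_coord (i : 'I_d) :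
  measurable_fun setT (fun x : borelRV R d => (x : V) 0 i).
Proof.
apply: (measurability _ (RGenOpens.measurableE R)) => _ [_ [a [b ->]] <-].
rewrite setTI; apply: sub_sigma_algebra; apply: open_comp => [x _|].
  exact: coord_continuous.
exact: interval_open.
Qed.

Definition upd (x : V) i t : V := \row_j if j == i then t else x 0 j.

Lemma upd_eq x i t : upd x i t 0 i = t.
Proof. by rewrite mxE eqxx. Qed.

Lemma upd_neq x i j t : j != i -> upd x i t 0 j = x 0 j.
Proof. by rewrite mxE => /negPf ->. Qed.

Lemma measurable_upd dT (T : measurableType dT) (f : T -> borelRV R d) (g : T -> R) i :
  measurable_fun setT f -> measurable_fun setT g ->
  measurable_fun setT (fun t => upd (f t) i (g t) : borelRV R d).
Proof.
move=> mf mg; apply: measurable_rV => j; under eq_fun do rewrite mxE.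
by case: eqP => // _; exact: (measurableT_comp (measurable_coord j)).
Qed.

Lemma open_borel (A : set V) : open A -> measurable (A : set (borelRV R d)).
Proof. exact: sub_sigma_algebra. Qed.

End Borel.

(** * Lower limits of extended real sequences *)

Section liminf.
Context {R : realType}.
Local Open Scope ereal_scope.

Lemma near_le_limn_einf (u v : (\bar R)^nat) :
  (\forall n \near \oo, u n <= v n) -> limn_einf u <= limn_einf v.
Proof.
move=> [N _ uv]; rewrite !limn_einf_lim; apply: lee_lim; try exact: is_cvg_einfs.
exists N => // n /= Nn; apply: le_ereal_inf_tmp => _ [m /= nm <-].
apply: le_trans (uv m _); last exact: leq_trans nm.
by apply: ereal_inf_lbound; exists m.
Qed.

Lemma near_eq_limn_einf (u v : (\bar R)^nat) :
  (\forall n \near \oo, u n = v n) -> limn_einf u = limn_einf v.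
Proof.
move=> uv; apply/eqP; rewrite eq_le; apply/andP; split;
  by apply: near_le_limn_einf; apply: filterS uv => n ->.
Qed.

Lemma limn_einf_cst (c : \bar R) : limn_einf (fun=> c) = c.
Proof. by have [->] := cvg_limn_einf_sup (cvg_cst c). Qed.

Lemma limn_einf_ge0 (u : (\bar R)^nat) : (forall n, 0 <= u n) -> 0 <= limn_einf u.
Proof.
move=> u0; rewrite -[X in X <= _]limn_einf_cst.
by apply: near_le_limn_einf; apply: nearW.
Qed.

Lemma measurable_fun_limn_einf d (T : measurableType d) (f : (T -> \bar R)^nat) :
  (forall n, measurable_fun setT (f n)) ->
  measurable_fun setT (fun x => limn_einf (f ^~ x)).
Proof.
move=> mf; rewrite /limn_einf; apply: measurableT_comp => //.
by apply: measurable_fun_limn_esup => // n; exact: measurableT_comp.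
Qed.

End liminf.

(** * Iterated integrals over selected coordinates *)

Section Iter.
Context {R : realType} {d : nat} (D : set R) (mD : measurable D).
Local Notation V := 'rV[R]_d.
Local Notation leb := (@lebesgue_measure R).
Local Open Scope ereal_scope.
Implicit Types (f g : V -> \bar R) (x : V) (s : seq 'I_d).

(** The result stays a function on the whole space, constant in coordinate [i]. Integrals in several
    coordinates can thus be composed without changing the dimension and without a Lebesgue measure
    on row vectors. *)
Definition int1 i f x := \int[leb]_(t in D) f (upd x i t).

(* The head of the list is the innermost integral. *)
Definition intn s f : V -> \bar R := foldl (fun g i => int1 i g) f s.

Local Notation "'mfun' f" := (measurable_fun [set: borelRV R d] f) (at level 10, f at level 9).

Lemma measurable_upd2 i x : measurable_fun setT (fun t : R => upd x i t : borelRV R d).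
Proof. exact: measurable_upd. Qed.

Lemma measurable_upd2D i x f : mfun f -> measurable_fun D (fun t => f (upd x i t)).
Proof.
move=> mf; apply: measurable_funTS; apply: measurableT_comp mf _.
exact: measurable_upd2.
Qed.

(** The parameter in [W] is carried along for the exchange with an integral over a second measure in
    [tonelli_intn]. Measurability is that of the sections in Tonelli's theorem, for the integrand
    set to zero outside [D]. *)
Lemma measurable_int1_param dW (W : measurableType dW) i (f : V * W -> \bar R) :
  measurable_fun [set: borelRV R d * W] f -> (forall p, 0 <= f p) ->
  measurable_fun [set: borelRV R d * W]
    (fun p => int1 i (fun x => f (x, p.2)) p.1).
Proof.
move=> mf f0.
pose h (q : (borelRV R d * W) * R) := (f (upd q.1.1 i q.2, q.1.2)).
pose A : set ((borelRV R d * W) * R) := setT `*` D.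
have mA : measurable A by exact: measurableX.
have -> : (fun p : borelRV R d * W => int1 i (fun x => f (x, p.2)) p.1) =
    fubini_F leb (h \_ A).
  apply/funext => p; rewrite /int1 integral_mkcond; apply: eq_integral => t _.
  rewrite /patch /A; congr (if _ then _ else _).
  by apply/idP/idP; rewrite !inE => //= -[].
apply: measurable_fun_fubini_tonelli_F.
  apply/(measurable_restrictT _ mA); apply: measurable_funTS.
  have m1 : measurable_fun setT (fun q : (borelRV R d * W) * R => q.1.1).
    exact: (measurableT_comp measurable_fst measurable_fst).
  have m2 : measurable_fun setT (fun q : (borelRV R d * W) * R => q.1.2).
    exact: (measurableT_comp measurable_snd measurable_fst).
  apply: measurableT_comp mf _; apply: measurable_fun_pair => //.
  exact: measurable_upd.
by move=> q; apply: erestrict_ge0 => *; exact: f0.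
Qed.

Lemma int1_ge0 i f : (forall x, 0 <= f x) -> forall x, 0 <= int1 i f x.
Proof. by move=> f0 x; exact: integral_ge0. Qed.

Lemma measurable_int1 i f : mfun f -> (forall x, 0 <= f x) -> mfun (int1 i f).
Proof.
move=> mf f0.
have := @measurable_int1_param _ (borelRV R d) i (fun p => f p.1).
move=> /(_ (measurableT_comp mf measurable_fst) (fun=> f0 _)) mF.
have md : measurable_fun setT (fun x : borelRV R d => (x, x)).
  exact: measurable_fun_pair.
exact: measurableT_comp mF md.
Qed.

Lemma intn_ge0 s f : (forall x, 0 <= f x) -> forall x, 0 <= intn s f x.
Proof. by elim: s f => //= i s IH f f0; apply: IH; exact: int1_ge0. Qed.

Lemma measurable_intn s f : mfun f -> (forall x, 0 <= f x) -> mfun (intn s f).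
Proof.
elim: s f => //= i s IH f mf f0; apply: IH; first exact: measurable_int1.
exact: int1_ge0.
Qed.

Lemma measurable_intn_param dW (W : measurableType dW) s (f : V * W -> \bar R) :
  measurable_fun [set: borelRV R d * W] f -> (forall p, 0 <= f p) ->
  measurable_fun [set: borelRV R d * W]
    (fun p => intn s (fun x => f (x, p.2)) p.1).
Proof.
elim: s f => [|i s IH] f mf f0 /=; first by under eq_fun do rewrite -surjective_pairing.
apply: (IH (fun p => int1 i (fun x => f (x, p.2)) p.1)).
  exact: measurable_int1_param.
by move=> p; apply: int1_ge0.
Qed.

(** Restricting the comparison to points with integrated coordinates in [D] matters later: densities
    are identified with mixed derivatives only at points with negative coordinates. *)
Lemma le_intn s f g : mfun f -> mfun g -> (forall x, 0 <= f x) -> (forall x, 0 <= g x) ->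
  (forall x, (forall j, j \in s -> D (x ord0 j)) -> f x <= g x) ->
  forall x, intn s f x <= intn s g x.
Proof.
elim: s f g => [|i s IH] f g mf mg f0 g0 fg x /=; first exact: fg.
apply: IH; [exact: measurable_int1|exact: measurable_int1|exact: int1_ge0|exact: int1_ge0|].
move=> y yD; apply: ge0_le_integral => //; [exact: measurable_upd2D..|].
move=> t Dt; apply: fg => j; rewrite in_cons mxE => /predU1P[->|/yD].
  by rewrite eqxx.
by case: eqP.
Qed.

Lemma intnD s f g : mfun f -> mfun g -> (forall x, 0 <= f x) -> (forall x, 0 <= g x) ->
  intn s (fun x => f x + g x) = fun x => intn s f x + intn s g x.
Proof.
elim: s f g => [//|i s IH] f g mf mg f0 g0 /=.
rewrite -IH; [|exact: measurable_int1|exact: measurable_int1|exact: int1_ge0|exact: int1_ge0].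
congr (intn s _); apply/funext => x.
by apply: ge0_integralD => //; exact: measurable_upd2D.
Qed.

(** Fatou's lemma once per coordinate: on the innermost integral first, then, by induction, on the
    functions [int1 i (f n)]. *)
Lemma fatou_intn s (f : (V -> \bar R)^nat) x : (forall n, mfun (f n)) ->
  (forall n x, 0 <= f n x) ->
  intn s (fun x => limn_einf (f ^~ x)) x <= limn_einf (fun n => intn s (f n) x).
Proof.
elim: s f x => [//|i s IH] f x mf f0 /=.
have mF n : mfun (int1 i (f n)) by exact: measurable_int1.
have F0 n y : 0 <= int1 i (f n) y by exact: int1_ge0.
have mL : mfun (fun x : V => limn_einf (f ^~ x)) by exact: measurable_fun_limn_einf.
have L0 (y : V) : 0 <= limn_einf (f ^~ y) by exact: limn_einf_ge0.
apply: le_trans (IH _ x mF F0); apply: le_intn.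
- exact: measurable_int1.
- exact: measurable_fun_limn_einf.
- exact: int1_ge0.
- by move=> y; exact: limn_einf_ge0.
- by move=> y _; apply: fatou => // n; exact: measurable_upd2D.
Qed.

Lemma tonelli_intn dW (W : measurableType dW) (nu : {sigma_finite_measure set W -> \bar R})
    s (f : V * W -> \bar R) x :
  measurable_fun [set: borelRV R d * W] f -> (forall p, 0 <= f p) ->
  intn s (fun x => \int[nu]_w f (x, w)) x = \int[nu]_w intn s (fun x => f (x, w)) x.
Proof.
elim: s f x => [//|i s IH] f x mf f0 /=.
rewrite -(IH (fun p => int1 i (fun x => f (x, p.2)) p.1)); last 2 first.
- exact: measurable_int1_param.
- by move=> p; exact: int1_ge0.
congr (intn s _ x); apply/funext => y; rewrite /int1 /= integral_mkcond.
under [RHS]eq_integral do rewrite integral_mkcond.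
(* Extending by zero outside [D] turns the exchange into Tonelli's theorem on a full product
   space. *)
pose h (q : R * W) := if q.1 \in D then f (upd y i q.1, q.2) else 0.
have -> : (fun t => \int[nu]_w f (upd y i t, w)) \_ D = fun t => \int[nu]_w h (t, w).
  apply/funext => t; rewrite /patch /h /=; case: ifP => // _.
  by rewrite integral0.
rewrite (fubini_tonelli (m1 := leb) h).
- by apply: eq_integral => w _; apply: eq_integral.
- pose A : set (R * W) := D `*` setT.
  have mA : measurable A by exact: measurableX.
  have -> : h = (fun q => f (upd y i q.1, q.2)) \_ A.
    apply/funext => q; rewrite /h /patch; congr (if _ then _ else _).
    by apply/idP/idP; rewrite !inE => //= -[].
  apply/(measurable_restrictT _ mA); apply: measurable_funTS.
  apply: (measurableT_comp mf); apply: measurable_fun_pair => //.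
  exact: measurable_upd.
- by move=> q; rewrite /h; case: ifP.
Qed.

End Iter.

(** * The lower density of a finite measure and its total integral *)

Section Density.
Context {R : realType} {d : nat}.
Local Notation V := 'rV[R]_d.
Local Notation leb := (@lebesgue_measure R).
Implicit Types (x z : V) (s : seq 'I_d) (l : seq ('I_d * nat)).

(** A half-open box with side [1 / (m + 1)] in each listed coordinate. The remaining coordinates
    range over lower rays, so that the empty list gives the event of the distribution function and
    listing one more coordinate amounts to taking one difference. *)
Definition cell l x : set V :=
  [set z | (forall p, p \in l -> x 0 p.1 < z 0 p.1 <= x 0 p.1 + p.2.+1%:R^-1) /\
           (forall j, j \notin unzip1 l -> z 0 j <= x 0 j)].

(** The reciprocal of the volume of the box: each factor is the inverse of a side length. *)
Definition cellvol l : R := \prod_(p <- l) p.2.+1%:R.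

Lemma cellvol_ge0 l : 0 <= cellvol l.
Proof. exact: prodr_ge0. Qed.

Definition quotient (mu : set V -> \bar R) l x : \bar R := ((cellvol l)%:E * mu (cell l x))%E.

(** The head of [s] carries the outermost limit, just as [partial] takes the derivative in the head
    direction last. Lower limits always exist, keep measurability and are what Fatou's lemma
    handles. *)
Fixpoint ilim s (q : seq ('I_d * nat) -> \bar R) : \bar R :=
  if s is i :: s' then limn_einf (fun m => ilim s' (fun l => q ((i, m) :: l)))
  else q [::].

Definition density (mu : set V -> \bar R) s x : \bar R := ilim s (fun l => quotient mu l x).

Lemma near_le_ilim s q q' (N : nat) :
  (forall l, unzip1 l = s -> all (fun p => N <= p.2)%N l -> (q l <= q' l)%E) ->
  (ilim s q <= ilim s q')%E.
Proof.
elim: s q q' => [|i s IH] q q' qq' /=; first exact: qq'.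
apply: near_le_limn_einf; exists N => // m /= Nm.
by apply: IH => l ls lN; apply: qq' => /=; [rewrite ls|rewrite Nm].
Qed.

Lemma near_eq_ilim s q q' (N : nat) :
  (forall l, unzip1 l = s -> all (fun p => N <= p.2)%N l -> q l = q' l) ->
  ilim s q = ilim s q'.
Proof.
move=> qq'; apply/eqP; rewrite eq_le; apply/andP; split;
  by apply: (@near_le_ilim _ _ _ N) => l ls lN; rewrite qq'.
Qed.

Lemma ilim_ge0 s q : (forall l, 0 <= q l)%E -> (0 <= ilim s q)%E.
Proof.
elim: s q => [|i s IH] q q0 //=; apply: limn_einf_ge0 => m; exact: IH.
Qed.

Lemma measurable_ilim s (q : seq ('I_d * nat) -> V -> \bar R) :
  (forall l, measurable_fun [set: borelRV R d] (q l)) ->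
  measurable_fun [set: borelRV R d] (fun x => ilim s (q ^~ x)).
Proof.
elim: s q => [|i s IH] q mq /=; first exact: mq.
by apply: measurable_fun_limn_einf => m; apply: (IH (fun l => q ((i, m) :: l))).
Qed.

(** The coordinates [s0] of integration are kept apart from the coordinates [s] of the limits
    because the induction uses up [s] while all the integrals remain. *)
Lemma fatou_ilim (D : set R) (mD : measurable D) s s0 (q : seq ('I_d * nat) -> V -> \bar R) x c :
  (forall l, measurable_fun [set: borelRV R d] (q l)) ->
  (forall l x, 0 <= q l x)%E ->
  (forall l, unzip1 l = s -> (intn D s0 (q l) x <= c)%E) ->
  (intn D s0 (fun x => ilim s (q ^~ x)) x <= c)%E.
Proof.
elim: s q => [|i s IH] q mq q0 qc /=; first exact: qc.
rewrite (le_trans (fatou_intn mD _ _ _ _))//.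
- by move=> m; apply: measurable_ilim => l; exact: mq.
- by move=> m y; apply: ilim_ge0 => l; exact: q0.
- rewrite -[leRHS]limn_einf_cst; apply: near_le_limn_einf; apply: nearW => m.
  by apply: (IH (fun l => q ((i, m) :: l))) => // l ls; apply: qc => /=; rewrite ls.
Qed.

(** Joint measurability in the corner and the point makes the measure of a cell measurable in its
    corner, and permits exchanging integration over the two. *)
Lemma measurable_cell_graph l :
  measurable [set p : borelRV R d * borelRV R d | cell l p.1 p.2].
Proof.
have mc1 j : measurable_fun setT (fun p : borelRV R d * borelRV R d => (p.1 : V) 0 j).
  exact: measurableT_comp (measurable_coord j) measurable_fst.
have mc2 j : measurable_fun setT (fun p : borelRV R d * borelRV R d => (p.2 : V) 0 j).
  exact: measurableT_comp (measurable_coord j) measurable_snd.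
have mlt (f g : borelRV R d * borelRV R d -> R) : measurable_fun setT f ->
    measurable_fun setT g -> measurable [set p | f p < g p].
  move=> mf mg; have := measurable_fun_ltr mf mg.
  by move=> /(_ measurableT [set true]); rewrite setTI; exact.
have mle (f g : borelRV R d * borelRV R d -> R) : measurable_fun setT f ->
    measurable_fun setT g -> measurable [set p | f p <= g p].
  move=> mf mg; have := measurable_fun_ler mf mg.
  by move=> /(_ measurableT [set true]); rewrite setTI; exact.
rewrite (_ : mkset _ =
  (\bigcap_(p in [set` l]) ([set w : borelRV R d * borelRV R d | (w.1 : V) 0 p.1 < (w.2 : V) 0 p.1]
    `&` [set w | (w.2 : V) 0 p.1 <= (w.1 : V) 0 p.1 + p.2.+1%:R^-1])) `&`
  \bigcap_(j in [set j | j \notin unzip1 l])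
    [set w : borelRV R d * borelRV R d | (w.2 : V) 0 j <= (w.1 : V) 0 j]).
  apply: measurableI; apply: fin_bigcap_measurable.
  - exact: finite_seq.
  - move=> p _; apply: measurableI; first exact: mlt.
    by apply: mle => //; apply: measurable_funD.
  - exact: finite_finset.
  - by move=> j _; exact: mle.
apply/seteqP; split=> [w [w1 w2]|w [w1 w2]]; split=> p pl.
- by have /andP[] := w1 p pl.
- exact: w2.
- by apply/andP; have [] := w1 p pl.
- exact: w2.
Qed.

Lemma measurable_cell l x : measurable (cell l x : set (borelRV R d)).
Proof.
have := measurable_xsection (x : borelRV R d) (measurable_cell_graph l).
by rewrite (_ : xsection _ _ = cell l x)//; apply/seteqP; split => z; rewrite /xsection/= ?inE.
Qed.

Lemma measurable_quotient (mu : {finite_measure set (borelRV R d) -> \bar R}) l :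
  measurable_fun [set: borelRV R d] (quotient mu l).
Proof.
apply: measurable_funeM.
have := measurable_fun_xsection mu (measurable_cell_graph l).
congr measurable_fun; apply/funext => x /=; congr (mu _).
by apply/seteqP; split => z; rewrite /xsection/= ?inE.
Qed.

Lemma quotient_ge0 (mu : {finite_measure set (borelRV R d) -> \bar R}) l x :
  (0 <= quotient mu l x)%E.
Proof. by apply: mule_ge0 => //; rewrite lee_fin cellvol_ge0. Qed.

Lemma measurable_density (mu : {finite_measure set (borelRV R d) -> \bar R}) s :
  measurable_fun [set: borelRV R d] (density mu s).
Proof. by apply: measurable_ilim => l; exact: measurable_quotient. Qed.

Lemma density_ge0 (mu : {finite_measure set (borelRV R d) -> \bar R}) s x :
  (0 <= density mu s x)%E.
Proof. by apply: ilim_ge0 => l; exact: quotient_ge0. Qed.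

(** The normalised indicator of [y < z <= y + 1 / (m + 1)], read as a function of the corner [y]
    with the point [z] fixed. *)
Definition bump (z : R) (m : nat) (y : R) : R :=
  m.+1%:R * \1_`[z - m.+1%:R^-1, z[%classic y.

Lemma bump_ge0 (z : R) m y : 0 <= bump z m y.
Proof. by rewrite mulr_ge0. Qed.

Lemma integral_bump (D : set R) (mD : measurable D) (z : R) m :
  (\int[leb]_(t in D) (bump z m t)%:E <= 1)%E.
Proof.
have mb : measurable_fun [set: R] (fun t => (bump z m t)%:E).
  by apply/measurable_EFinP; apply: measurable_funM => //; exact: measurable_indic.
apply: (@le_trans _ _ (\int[leb]_t (bump z m t)%:E)%E).
  by apply: ge0_subset_integral => // t _; rewrite lee_fin bump_ge0.
under eq_integral do rewrite EFinM.
rewrite ge0_integralZl//; last first.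
  by apply/measurable_EFinP; exact: measurable_indic.
rewrite integral_indic// setIT /= lebesgue_measure_itv/= lte_fin ltrBlDr ltrDl invr_gt0 ltr0n/=.
by rewrite -EFinB -EFinM opprB addrCA subrr addr0 divff.
Qed.

Lemma measurable_bump_prod l z :
  measurable_fun [set: borelRV R d]
    (fun x => (\prod_(p <- l) bump (z 0 p.1) p.2 ((x : V) 0 p.1))%:E).
Proof.
apply/measurable_EFinP; apply: measurable_prod => p _.
apply: measurable_funM => //.
have mi : measurable_fun [set: R] (\1_`[z 0 p.1 - p.2.+1%:R^-1, z 0 p.1[%classic : R -> R).
  exact: measurable_indic.
exact: measurableT_comp mi (measurable_coord _).
Qed.

(** As the coordinates are distinct, each integral meets exactly one factor and the others come out
    as constants. *)
Lemma intn_bump (D : set R) (mD : measurable D) l z x : uniq (unzip1 l) ->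
  (intn D (unzip1 l) (fun x => (\prod_(p <- l) bump (z 0 p.1) p.2 ((x : V) 0 p.1))%:E) x <= 1)%E.
Proof.
elim: l => [_|[i m] l IH] /=; first by rewrite big_nil.
move=> /andP[il /IH]; apply: le_trans; apply: le_intn => //.
- apply: measurable_int1 => //; first exact: (measurable_bump_prod ((i, m) :: l)).
  by move=> y; rewrite lee_fin; apply: prodr_ge0 => *; exact: bump_ge0.
- exact: measurable_bump_prod.
- apply: int1_ge0 => y; rewrite lee_fin; apply: prodr_ge0 => *; exact: bump_ge0.
- by move=> y; rewrite lee_fin; apply: prodr_ge0 => *; exact: bump_ge0.
move=> y _; rewrite /int1.
under eq_integral => t _.
  rewrite big_cons /= upd_eq EFinM muleC.
  rewrite (eq_big_seq (fun p => bump (z 0 p.1) p.2 (y 0 p.1))); last first.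
    move=> p pl; rewrite upd_neq//; apply: contraNneq il => <-.
    exact: map_f.
  over.
rewrite ge0_integralZl//.
- rewrite -[leRHS]mule1 lee_wpmul2l ?integral_bump// lee_fin.
  by apply: prodr_ge0 => *; exact: bump_ge0.
- apply: measurable_funTS.
  by apply/measurable_EFinP; apply: measurable_funM => //; exact: measurable_indic.
- by move=> t _; rewrite lee_fin bump_ge0.
- by rewrite lee_fin; apply: prodr_ge0 => *; exact: bump_ge0.
Qed.

(** The quotient is the [mu]-integral over [z] of a kernel. After exchanging the integrals, the
    kernel for fixed [z] is at most a product of bumps, whose iterated integral is at most 1. *)
Lemma intn_quotient (D : set R) (mD : measurable D)
    (mu : {finite_measure set (borelRV R d) -> \bar R}) l x : uniq (unzip1 l) ->
  (intn D (unzip1 l) (quotient mu l) x <= mu setT)%E.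
Proof.
move=> ul; pose G := [set p : borelRV R d * borelRV R d | cell l p.1 p.2].
have mG : measurable G := measurable_cell_graph l.
pose f (p : borelRV R d * borelRV R d) := ((cellvol l)%:E * (\1_G p)%:E)%E.
have m1 : measurable_fun setT (fun p => (\1_G p)%:E : \bar R).
  by apply/measurable_EFinP; exact: measurable_indic.
have mf : measurable_fun setT f by exact: measurable_funeM.
have f0 p : (0 <= f p)%E by rewrite mule_ge0// lee_fin ?cellvol_ge0.
have -> : quotient mu l = fun y => (\int[mu]_z f (y, z))%E.
  apply/funext => y; rewrite ge0_integralZl ?lee_fin ?cellvol_ge0//; last first.
    exact: measurableT_comp m1 (pair1_measurable (y : borelRV R d)).
  congr (_ * _)%E; rewrite (_ : (fun _ => _) = fun z => (\1_(cell l y) z)%:E).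
    by rewrite integral_indic ?setIT//; exact: measurable_cell.
  by apply/funext => z; rewrite !indicE; congr (_%:R)%:E; apply/idP/idP; rewrite !inE.
rewrite (tonelli_intn mD mu)//.
rewrite -[leRHS](mul1e (mu setT)) -integral_cst//; apply: ge0_le_integral => //.
- by move=> z _; exact: intn_ge0.
- have := measurable_intn_param mD (unzip1 l) mf f0.
  by move=> /measurableT_comp /(_ (pair1_measurable (x : borelRV R d))).
move=> z _; apply: le_trans (intn_bump mD z x ul).
apply: le_intn => //.
- by apply: measurableT_comp mf _; exact: pair2_measurable.
- exact: measurable_bump_prod.
- by move=> y; rewrite lee_fin; apply: prodr_ge0 => *; exact: bump_ge0.
move=> y _; rewrite /f -EFinM lee_fin indicE; have [|_] := boolP ((y, z) \in G); last first.
  by rewrite mulr0; apply: prodr_ge0 => *; exact: bump_ge0.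
rewrite inE => -[/= h _]; rewrite mulr1 /cellvol le_eqVlt; apply/orP; left; apply/eqP.
apply: eq_big_seq => p pl; rewrite /bump indicE mem_set ?mulr1//=.
by have /andP[h1 h2] := h _ pl; rewrite in_itv/= h1 lerBlDr h2.
Qed.

Lemma intn_density (D : set R) (mD : measurable D)
    (mu : {finite_measure set (borelRV R d) -> \bar R}) s x : uniq s ->
  (intn D s (density mu s) x <= mu setT)%E.
Proof.
move=> us; apply: fatou_ilim => //.
- exact: measurable_quotient.
- by move=> l y; exact: quotient_ge0.
- by move=> l ls; move: us; rewrite -ls => us; exact: intn_quotient.
Qed.

End Density.

(** * Regularity of finite Borel measures on R^d *)

Section Regularity.
Context {R : realType} {d : nat}.
Local Notation V := 'rV[R]_d.
Variable mu : {finite_measure set (borelRV R d) -> \bar R}.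
Local Open Scope ereal_scope.

Definition regular_set (A : set (borelRV R d)) :=
  forall e : R, (0 < e)%R -> exists F U : set V,
    [/\ closed F, open U, F `<=` A, A `<=` U & mu (U `\` F) <= e%:E].

Lemma closed_borel (A : set V) : closed A -> measurable (A : set (borelRV R d)).
Proof.
move=> cA; rewrite -[A]setCK; apply: measurableC; apply: open_borel.
exact: closed_openC.
Qed.

(** The closed sets [F n] of points outside every ball of radius [1 / (n + 1)] about a point of the
    complement exhaust [U], so by continuity from above the measure of the remainder tends to 0. *)
Lemma regular_open (U : set V) : open U -> regular_set U.
Proof.
move=> oU e e0.
pose F n : set V := ~` \bigcup_(y in ~` U) ball y n.+1%:R^-1.
have cF n : closed (F n).
  apply: open_closedC; apply: bigcup_open => y _.
  by apply: ball_open; rewrite invr_gt0.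
have FU n : F n `<=` U.
  move=> x Fx; apply: contrapT => Ux; apply: Fx; exists x => //.
  by apply: ballxx; rewrite invr_gt0.
pose E n := U `\` F n.
have mE n : measurable (E n : set (borelRV R d)).
  by apply: measurableD; [exact: open_borel|exact: closed_borel].
have E0 : \bigcap_n E n = set0.
  apply/seteqP; split => // x Ex.
  have [Ux _] := Ex 0%N I.
  move: oU; rewrite openE => /(_ _ Ux) /nbhs_ballP[r r0 rU].
  have [k _ /(_ k (leqnn k)) kr] := near_infty_natSinv_lt (PosNum r0).
  have [_] := Ex k I; apply => -[y Uy yx]; apply: Uy; apply: rU.
  by apply: ball_sym; apply: le_ball yx; exact: ltW.
have cvE : mu \o E @ \oo --> mu (\bigcap_n E n).
  apply: nonincreasing_cvg_mu => //.
  - by rewrite ltey_eq fin_num_measure.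
  - by rewrite E0.
  - move=> m n mn; apply/subsetPset => x [Ux Fx]; split => //; apply: contra_not Fx.
    move=> Fmx [y Uy yx]; apply: Fmx; exists y => //; apply: le_ball yx.
    by rewrite lef_pV2 ?posrE// ler_nat.
rewrite E0 measure0 in cvE.
have /fine_cvgP[_ /cvgrPdist_le /(_ e e0)[N _ /(_ N (leqnn N))]] := cvE.
rewrite /= sub0r normrN => h; exists (F N), U; split => //.
rewrite -[X in X <= _](@fineK _ (mu (E N))) ?fin_num_measure// lee_fin.
exact: le_trans (ler_norm _) h.
Qed.

Lemma regular_setC (A : set V) : regular_set A -> regular_set (~` A).
Proof.
move=> rA e /rA[F [U [cF oU FA AU le]]]; exists (~` U), (~` F); split.
- exact: open_closedC.
- exact: closed_openC.
- exact: subsetC.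
- exact: subsetC.
- by rewrite setDE setCK setIC -setDE.
Qed.

(** A countable union of closed sets may fail to be closed, so only finitely many are kept. One half
    of [e] pays for the errors of all the single sets, the other half for cutting the union at
    [N]. *)
Lemma regular_bigcup (A : (set V)^nat) : (forall n, regular_set (A n)) ->
  regular_set (\bigcup_n A n).
Proof.
move=> rA e e0.
have e2 n : (0 < e / 2 / (2 ^ n.+1)%:R)%R by rewrite !divr_gt0// ltr0n expn_gt0.
have /choice[FU] : forall n, exists FU : set V * set V,
    [/\ closed FU.1, open FU.2, FU.1 `<=` A n, A n `<=` FU.2 &
        mu (FU.2 `\` FU.1) <= (e / 2 / (2 ^ n.+1)%:R)%:E].
  by move=> n; have [F [U h]] := rA n _ (e2 n); exists (F, U).
move=> /all_and5[cF oU FA AU FUe].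
pose U := \bigcup_n (FU n).2; pose F n := \big[setU/set0]_(i < n) (FU i).1.
have oUU : open U by exact: bigcup_open.
have cFF n : closed (F n) by exact: closed_bigsetU.
pose E n := U `\` F n.
have mU : measurable (U : set (borelRV R d)) by exact: open_borel.
have mE n : measurable (E n : set (borelRV R d)).
  by apply: measurableD => //; exact: closed_borel.
pose W := \bigcap_n E n.
have mW : measurable (W : set (borelRV R d)) by exact: bigcapT_measurable.
have mUF n : measurable ((FU n).2 `\` (FU n).1 : set (borelRV R d)).
  by apply: measurableD; [exact: open_borel|exact: closed_borel].
(* [W] is the part of the open set missed by all the closed sets; it lies in the union of the single
   differences, whose bounds sum to [e / 2]. *)
have muW : mu W <= (e / 2)%:E.
  apply: (@le_trans _ _ (\sum_(n <oo) mu ((FU n).2 `\` (FU n).1))).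
    apply: measure_sigma_subadditive => // x Wx.
    have [[n _ Ux] _] := Wx 0%N I; exists n => //; split => //.
    have [_] := Wx n.+1 I; apply: contra_not => Fx.
    by rewrite /F big_ord_recr/=; right.
  apply: le_trans (epsilon_trick0 _ _); last by rewrite divr_ge0// ltW.
  by apply: lee_nneseries => // n _.
have cvE : mu \o E @ \oo --> mu W.
  apply: nonincreasing_cvg_mu => //.
  - by rewrite ltey_eq fin_num_measure.
  - move=> m n mn; apply/subsetPset => x [Ux Fx]; split => //; apply: contra_not Fx.
    exact: (@subset_bigsetU _ (fun i => (FU i).1) _ _ mn).
have e20 : (0 < e / 2)%R by rewrite divr_gt0.
have := cvE; rewrite -(fineK (fin_num_measure mu _ mW)).
move=> /fine_cvgP[_ /cvgrPdist_le /(_ _ e20)[N _ /(_ N (leqnn N)) /=]] h.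
exists (F N), U; split => //.
- move=> x; rewrite /F -(bigcup_mkord N (fun i => (FU i).1)) => -[n _ Fx].
  by exists n => //; exact: FA.
- by move=> x [n _ Ax]; exists n => //; exact: AU.
rewrite -[X in X <= _](@fineK _ (mu (E N))) ?fin_num_measure// lee_fin.
have : (fine (mu W) <= e / 2)%R by rewrite -lee_fin fineK// fin_num_measure.
move: h; rewrite ler_distl /E => /andP[+ _]; move: (fine _) (fine _) => a b; lra.
Qed.

Lemma regular_measurable (A : set (borelRV R d)) : measurable A -> regular_set A.
Proof.
have : sigma_algebra setT regular_set.
  split.
  - exact: (regular_open open0).
  - by move=> B rB; rewrite setTD; exact: regular_setC.
  - exact: regular_bigcup.
by move=> /smallest_sub; apply; exact: regular_open.
Qed.

Lemma outer_regular (A : set (borelRV R d)) (e : R) : measurable A -> (0 < e)%R ->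
  exists U : set V, [/\ open U, A `<=` U & mu U <= mu A + e%:E].
Proof.
move=> mA e0; have [F [U [cF oU FA AU le]]] := regular_measurable mA e0.
exists U; split => //.
have mU := open_borel oU; have mF := closed_borel cF.
rewrite -[X in (mu X <= _)%E](setDUK AU).
apply: (le_trans (measureU2 _ _ _)) => //; first exact: measurableD.
rewrite leeD2l// (le_trans _ le)// le_measure ?inE//; [exact: measurableD..|].
exact: setDS.
Qed.

End Regularity.

(** * The density integrates to at most the measure on every Borel set *)

Section DensityBorel.
Context {R : realType} {d : nat}.
Local Notation V := 'rV[R]_d.
Variable mu : {finite_measure set (borelRV R d) -> \bar R}.
Implicit Types (x : V) (s : seq 'I_d).

(** The density is local: once all sides are short, the cell at [x] lies inside [U]. All coordinates
    must be listed for this, since an unlisted one leaves the cell unbounded. *)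
Lemma density_mrestr s (U : set V) (mU : measurable (U : set (borelRV R d))) x :
  open U -> U x -> (forall j, j \in s) ->
  density (mrestr mu mU) s x = density mu s x.
Proof.
move=> oU Ux js.
have /nbhs_ballP[r r0 rU] : nbhs x U by exact: open_nbhs_nbhs.
have [k _ /(_ k (leqnn k)) kr] := near_infty_natSinv_lt (PosNum r0).
apply: (@near_eq_ilim _ _ _ _ _ k) => l ls lk; rewrite /quotient /mrestr.
congr (_ * mu _)%E; apply/setIidl => z [z1 z2]; apply: rU; split => // i j.
have /mapP[p pl ->] : j \in unzip1 l by rewrite ls.
have /andP[h1 h2] := z1 p pl; rewrite ord1 /ball/= ltr_distlC.
have pk : p.2.+1%:R^-1 <= k.+1%:R^-1 :> R.
  by rewrite lef_pV2 ?posrE// ler_nat ltnS; exact: (allP lk).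
rewrite (lt_le_trans _ (ltW h1)) ?ltrBlDr ?ltrDl//= (le_lt_trans h2)// ltrD2l.
exact: le_lt_trans kr.
Qed.

(** This is the bound by the total mass, applied to [mu] restricted to [U], which has the same
    density at the points of [U]. *)
Lemma intn_density_open (D : set R) (mD : measurable D) s (U : set V) x :
  open U -> uniq s -> (forall j, j \in s) ->
  (intn D s (density mu s \_ U) x <= mu U)%E.
Proof.
move=> oU us js.
have mU : measurable (U : set (borelRV R d)) := open_borel oU.
have muU : (mu U < +oo)%E by rewrite ltey_eq fin_num_measure.
pose nu : {finite_measure set (borelRV R d) -> \bar R} := mfrestr mU muU.
have := intn_density mD nu x us; rewrite {2}/nu/= /mfrestr /mrestr setTI.
apply: le_trans; apply: le_intn => //.
- by apply/(measurable_restrictT _ mU); apply: measurable_funTS; exact: measurable_density.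
- exact: (measurable_density nu).
- by move=> y; apply: erestrict_ge0 => *; exact: density_ge0.
- by move=> y; exact: (density_ge0 nu).
move=> y _; rewrite /patch; case: ifPn => [|_]; last exact: (density_ge0 nu).
by rewrite inE => Uy; rewrite -(density_mrestr mU).
Qed.

Lemma intn_density_borel (D : set R) (mD : measurable D) s (A : set (borelRV R d)) x :
  measurable A -> uniq s -> (forall j, j \in s) ->
  (intn D s (density mu s \_ A) x <= mu A)%E.
Proof.
move=> mA us js; apply/lee_addgt0Pr => e e0.
have [U [oU AU]] := outer_regular mu mA e0; apply: le_trans.
apply: le_trans (intn_density_open mD x oU us js).
have mU : measurable (U : set (borelRV R d)) := open_borel oU.
apply: le_intn => //.
- by apply/(measurable_restrictT _ mA); apply: measurable_funTS; exact: measurable_density.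
- by apply/(measurable_restrictT _ mU); apply: measurable_funTS; exact: measurable_density.
- by move=> y; apply: erestrict_ge0 => *; exact: density_ge0.
- by move=> y; apply: erestrict_ge0 => *; exact: density_ge0.
move=> y _; rewrite /patch; case: ifPn => [|_]; last by case: ifP => // _; exact: density_ge0.
by rewrite inE => Ay; rewrite mem_set//; exact: AU.
Qed.

End DensityBorel.

(** * The density as a mixed partial derivative of the distribution function *)

Section DensityPartial.
Context {R : realType} {d : nat}.
Local Notation V := 'rV[R]_d.
Implicit Types (x : V) (s : seq 'I_d) (l : seq ('I_d * nat)) (F : V -> R).

Lemma coord_shift x i j (t : R) : (x + t *: dir i) 0 j = x 0 j + t *+ (j == i).
Proof. by rewrite !mxE eqxx /= mulr_natr. Qed.

Definition df (mu : set V -> \bar R) x : R := fine (mu [set z | vle z x]).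

Fixpoint diffq l F x : R :=
  if l is p :: l' then
    p.2.+1%:R * (diffq l' F (x + p.2.+1%:R^-1 *: dir p.1) - diffq l' F x)
  else F x.

Lemma cell_nil x : cell [::] x = [set z | vle z x].
Proof. by apply/seteqP; split=> [z [_ zx] i|z zx]; [exact: zx|split=> // j _; exact: zx]. Qed.

Lemma cell_cons p l x : p.1 \notin unzip1 l ->
  cell (p :: l) x = cell l (x + p.2.+1%:R^-1 *: dir p.1) `\` cell l x.
Proof.
move=> pl; have ne q : q \in l -> (q.1 == p.1) = false.
  by move=> ql; apply: contraNF pl => /eqP <-; exact: map_f.
apply/seteqP; split=> z.
  move=> [z1 z2]; have /andP[zp1 zp2] := z1 p (mem_head _ _); split.
    split=> [q ql|j jl]; rewrite coord_shift.
      by rewrite ne// addr0; apply: z1; rewrite in_cons ql orbT.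
    have [->|jp] := eqVneq j p.1; first exact: zp2.
    by rewrite addr0; apply: z2; rewrite in_cons negb_or jp.
  by move=> [_ /(_ _ pl)]; rewrite leNgt zp1.
move=> [[z1 z2] zn]; split=> [q|j].
  rewrite in_cons => /predU1P[->|ql].
    have := z2 _ pl; rewrite coord_shift eqxx => ->; rewrite andbT ltNge.
    apply/negP => zx; apply: zn; split=> [r rl|j jl].
      by have := z1 r rl; rewrite coord_shift ne// addr0.
    have := z2 j jl; rewrite coord_shift; case: eqP => [->//|_]; by rewrite addr0.
  by have := z1 q ql; rewrite coord_shift ne// addr0.
rewrite in_cons negb_or => /andP[jp jl].
by have := z2 j jl; rewrite coord_shift (negPf jp) addr0.
Qed.

Lemma cell_shift p l x : p.1 \notin unzip1 l ->
  cell l x `<=` cell l (x + p.2.+1%:R^-1 *: dir p.1).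
Proof.
move=> pl z [z1 z2]; split=> [q ql|j jl]; rewrite coord_shift.
  have -> : (q.1 == p.1) = false.
    by apply: contraNF pl => /eqP <-; exact: map_f.
  by rewrite addr0; exact: z1.
by rewrite (le_trans (z2 j jl))// lerDl mulrn_wge0.
Qed.

(** Inclusion-exclusion one coordinate at a time: by [cell_cons], a cell with one more listed
    coordinate is the difference of two nested cells. *)
Lemma quotient_diffq (mu : {finite_measure set (borelRV R d) -> \bar R}) l x :
  uniq (unzip1 l) -> quotient mu l x = (diffq l (df mu) x)%:E.
Proof.
rewrite /quotient /cellvol.
elim: l x => [|p l IH] x /=.
  move=> _; rewrite big_nil mul1e cell_nil fineK// fin_num_measure//.
  by rewrite -cell_nil; exact: measurable_cell.
move=> /andP[pl ul]; rewrite big_cons cell_cons//.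
rewrite measureD; [|exact: measurable_cell|exact: measurable_cell|]; last first.
  by rewrite ltey_eq fin_num_measure//; exact: measurable_cell.
rewrite (setIidr (cell_shift pl)) EFinM -muleA muleBr//; last first.
  by rewrite fin_num_adde_defr// fin_num_measure//; exact: measurable_cell.
by rewrite !IH// -EFinB EFinM.
Qed.

(** Genuine iterated limits, with inner limits [u m] required only for large [m]. They are used
    besides [ilim] because limits can be subtracted, which lower limits do not permit. *)
Fixpoint itlim s (q : seq ('I_d * nat) -> R) (a : R) : Prop :=
  if s is i :: s' then
    exists u : nat -> R,
      (\forall m \near \oo, itlim s' (fun l => q ((i, m) :: l)) (u m)) /\
      u @ \oo --> a
  else q [::] = a.

Lemma itlim_ilim s q a : itlim s q a -> ilim s (fun l => (q l)%:E) = a%:E.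
Proof.
elim: s q a => [q a /= -> //|i s IH q a [u [qu ua]] /=].
rewrite (@near_eq_limn_einf _ _ (fun m => (u m)%:E)).
  have uE : (fun m => (u m)%:E) @ \oo --> a%:E.
    by apply/fine_cvgP; split=> //; exact: nearW.
  by have [-> _] := cvg_limn_einf_sup uE.
by apply: filterS qu => m; exact: IH.
Qed.

Lemma itlimB s q1 q2 a1 a2 c : itlim s q1 a1 -> itlim s q2 a2 ->
  itlim s (fun l => c * (q1 l - q2 l)) (c * (a1 - a2)).
Proof.
elim: s q1 q2 a1 a2 => [|i s IH] q1 q2 a1 a2 /=; first by move=> -> ->.
move=> [u1 [qu1 ua1]] [u2 [qu2 ua2]]; exists (fun m => c * (u1 m - u2 m)); split.
  by apply: filterS2 qu1 qu2 => m; exact: IH.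
by apply: cvgM; [exact: cvg_cst|exact: cvgB].
Qed.

Lemma cvg_natSinv_dnbhs : (fun m : nat => m.+1%:R^-1 : R) @ \oo --> (0 : R)^'.
Proof.
move=> A /nbhs_ballP[e e0 eA].
have := near_infty_natSinv_lt (PosNum e0); apply: filterS => m me.
apply: eA; last by rewrite invr_eq0 pnatr_eq0.
by rewrite /ball/= sub0r normrN ger0_norm.
Qed.

(** For fixed outer step the inner limits give a difference quotient of [partial s F], at two points
    where the inner derivatives exist once the step is small; the outer limit is then the derivative
    along [1 / (m + 1)]. *)
Lemma itlim_partial s F x : has_partial s F x ->
  itlim s (fun l => diffq l F x) (partial s F x).
Proof.
elim: s x => [//|i s IH] x /= [[e /= e0 nx] dx].
exists (fun m => m.+1%:R * (partial s F (x + m.+1%:R^-1 *: dir i) - partial s F x)); split.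
  have := near_infty_natSinv_lt (PosNum e0); apply: filterS => m me.
  apply: itlimB; apply: IH.
    by apply: nx; rewrite /ball_/= sub0r normrN ger0_norm.
  have := nx 0; rewrite scale0r addr0; apply.
  by rewrite /ball_/= subrr normr0.
have := cvg_comp _ _ cvg_natSinv_dnbhs dx.
rewrite -/('D_(dir i) (partial s F) x).
apply: cvg_trans; apply: near_eq_cvg; apply: nearW => m /=.
by rewrite invrK [X in partial s F X - _]addrC.
Qed.

Lemma density_partial (mu : {finite_measure set (borelRV R d) -> \bar R}) s x :
  uniq s -> has_partial s (df mu) x -> density mu s x = (partial s (df mu) x)%:E.
Proof.
move=> us hp; rewrite -(itlim_ilim (itlim_partial hp)).
by apply: (@near_eq_ilim _ _ _ _ _ 0) => l ls _; rewrite quotient_diffq// ls.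
Qed.

End DensityPartial.

(** * Increments of an everywhere differentiable function and the integral of a bound on its
    derivative *)

Section FTC.
Context {R : realType}.
Local Notation leb := (@lebesgue_measure R).
Local Notation RR := (measurableTypeR R).

(** Continuous induction: the supremum of the points where [Q] holds satisfies [Q] by a step ending
    there, and it equals [b] since a step starting there would otherwise go beyond it. *)
Lemma real_induction (Q : R -> Prop) a b : a <= b -> Q a ->
  (forall x, a <= x <= b -> exists2 e, 0 < e & forall y z, a <= y -> y <= z -> z <= b ->
     (y = x \/ z = x) -> z - y < e -> Q y -> Q z) ->
  Q b.
Proof.
move=> ab Qa step; pose S := [set y | [/\ a <= y, y <= b & Q y]].
have Sa : S a by split.
have hS : has_sup S by split; [exists a|exists b => y []].
have aS : a <= sup S by exact: ub_le_sup hS.2 _ Sa.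
have Sb : sup S <= b by apply: ge_sup; [exists a|move=> y []].
have [|e e0 he] := step (sup S); first by rewrite aS.
have [y [ay yb Qy] ySe] := sup_adherent e0 hS.
have yS : y <= sup S by apply: ub_le_sup hS.2 _ _.
have QS : Q (sup S).
  by apply: (he y) => //; [right|rewrite ltrBlDr addrC -ltrBlDr].
have [bS|Sltb] := leP b (sup S); first by have -> : b = sup S by apply/le_anti/andP.
pose z := Num.min b (sup S + e / 2).
have Sz : sup S < z by rewrite lt_min Sltb ltrDl divr_gt0.
have : S z.
  split; [by rewrite (le_trans aS)// ltW|by rewrite ge_min lexx|].
  apply: (he (sup S)) => //; [exact: ltW|by rewrite ge_min lexx|by left|].
  rewrite ltrBlDr gt_min; apply/orP; right.
  by rewrite addrC ltrD2r ltr_pdivrMr// ltr_pMr// ltr1n.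
by move/(ub_le_sup hS.2); rewrite leNgt Sz.
Qed.

(** This splits the error of [open_weight]: [2 * eta * L] for rounding [g] to levels on a set of
    measure [L], and [e / 2] for enlarging the level sets to open ones. *)
Lemma small_factor (e L : R) : 0 < e -> 0 <= L ->
  exists2 eta, 0 < eta & 2 * eta * L + e / 2 <= e.
Proof.
move=> e0 L0; exists (e / (2 * (2 * L + 1))).
  by rewrite divr_gt0// mulr_gt0// ltr_wpDl// mulr_ge0.
have -> : 2 * (e / (2 * (2 * L + 1))) * L = e / 2 * (2 * L / (2 * L + 1)).
  by field; lra.
suff : e / 2 * (2 * L / (2 * L + 1)) <= e / 2 by lra.
apply: ler_piMr; first by lra.
by rewrite ler_pdivrMr ?mul1r; lra.
Qed.

(* The Vitali-Caratheodory theorem with lower semicontinuity of [w] replaced by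
   what is used of it: near [x], [w] stays above a constant exceeding [r]. *)
Lemma open_weight (D : set RR) (g : RR -> \bar R) (e : R) : measurable D ->
  (leb D < +oo)%E -> leb.-integrable D g -> (forall x, D x -> 0 <= g x)%E -> 0 < e ->
  exists w : RR -> \bar R, [/\ measurable_fun setT w, forall x, (0 <= w x)%E,
    (\int[leb]_(x in D) w x <= \int[leb]_(x in D) g x + e%:E)%E &
    forall x (r : R), D x -> (r%:E <= g x)%E -> exists c : R, exists U : set R,
      [/\ r < c, 0 <= c, open U, U x & forall y, U y -> (c%:E <= w y)%E]].
Proof.
move=> mD lD ig g0 e0; have mg := measurable_int _ ig.
have [L lDr L0] : exists2 L, leb D = L%:E & 0 <= L.
  by exists (fine (leb D)); [rewrite fineK// ge0_fin_numE|exact: fine_ge0].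
have [eta eta0 etaL] := small_factor e0 L0.
(* On the level set [E k] the value of [g] is in [[k * eta, (k + 1) * eta[], so [c k] is strictly
   above [g] and at most [2 * eta] above it. *)
pose c (k : nat) : R := (k.+2)%:R * eta.
have c0 k : 0 < c k by rewrite mulr_gt0.
pose E (k : nat) : set RR := D `&` g @^-1` `[(k%:R * eta)%:E, (k.+1%:R * eta)%:E[%classic.
have mE k : measurable (E k).
  by apply: mg => //; exact: emeasurable_itv.
(* Where [g] is infinite no finite level is enough. This set is null by integrability, so adding it
   to every [E k] costs nothing and puts its points into every [U k]. *)
pose Eoo : set RR := D `&` g @^-1` [set +oo%E].
have mEoo : measurable Eoo by apply: mg => //; exact: emeasurable_set1.
have Eoo0 : leb Eoo = 0%E.
  have [B [mB B0 AB]] := @integrable_ae _ _ R leb D mD g ig.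
  apply/le_anti/andP; split=> //; rewrite -B0; apply: le_measure; rewrite ?inE//.
  move=> x [Dx gx]; apply: AB => /(_ Dx).
  by rewrite gx.
have finE k : (leb (E k `|` Eoo) < +oo)%E.
  rewrite (measureU0 (mE k) mEoo Eoo0); apply: (le_lt_trans _ lD).
  by apply: le_measure; rewrite ?inE//; move=> x [].
(* Divided by [c k], so that after weighting by [c k] the excess measures sum to [e / 2]. *)
pose er k := e / 2 / (2 ^ k.+1)%:R / c k.
have er0 k : 0 < er k by rewrite !divr_gt0// ltr0n expn_gt0.
have /choice[U] : forall k, exists U : set RR,
    [/\ open U, E k `|` Eoo `<=` U & (leb U <= leb (E k) + (er k)%:E)%E].
  move=> k; have mA : measurable (E k `|` Eoo) by exact: measurableU.
  have [U [oU AU /ltW lU]] := lebesgue_regularity_outer mA (finE k) (er0 k).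
  have mU : measurable (U : set RR) := open_measurable oU.
  exists U; split => //; rewrite -(measureU0 (mE k) mEoo Eoo0).
  rewrite -[X in (leb X <= _)%E](setDUK AU).
  apply: (le_trans (measureU2 _ _ _)) => //; first exact: measurableD.
  by rewrite leeD2l.
move=> /all_and3[oU AU lU].
have mU k : measurable (U k) by exact: open_measurable.
pose w (x : RR) := (\sum_(0 <= k <oo) (c k)%:E * (\1_(U k) x)%:E)%E.
have mw1 k : measurable_fun [set: RR] (fun x => (c k)%:E * (\1_(U k) x)%:E)%E.
  by apply: measurable_funeM; apply/measurable_EFinP; exact: measurable_indic.
have w10 k x : (0 <= (c k)%:E * (\1_(U k) x)%:E)%E.
  by rewrite mule_ge0 ?lee_fin// ltW.
exists w; split.
- by apply: ge0_emeasurable_sum => // k x _ _; exact: w10.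
- by move=> x; apply: nneseries_ge0 => k _ _; exact: w10.
- rewrite integral_nneseries//; last by move=> k; exact: measurable_funTS.
  have intU k : (\int[leb]_(x in D) ((c k)%:E * (\1_(U k) x)%:E) <=
      (c k)%:E * leb (E k) + (e / 2 / (2 ^ k.+1)%:R)%:E)%E.
    rewrite ge0_integralZl ?lee_fin//; last 2 first.
    - by apply/measurable_EFinP; exact: measurable_indic.
    - exact: ltW.
    rewrite integral_indic//.
    apply: (@le_trans _ _ ((c k)%:E * (leb (E k) + (er k)%:E))%E).
      apply: lee_wpmul2l; first by rewrite lee_fin ltW.
      apply: le_trans (lU k); apply: le_measure; rewrite ?inE//.
      exact: measurableI.
    rewrite ge0_muleDr ?lee_fin ?(ltW (er0 k))// -EFinM /er.
    by rewrite [c k * _]mulrC divfK// gt_eqF.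
  apply: (@le_trans _ _ (\sum_(0 <= k <oo) ((c k)%:E * leb (E k) + (e / 2 / (2 ^ k.+1)%:R)%:E))%E).
    by apply: lee_nneseries => // k _ _; exact: integral_ge0.
  apply: (le_trans (epsilon_trick _ _ _)).
  - by move=> k; rewrite mule_ge0// lee_fin ltW.
  - by rewrite divr_ge0// ltW.
  have gE : (\sum_(0 <= k <oo) ((c k)%:E * leb (E k)) <= \int[leb]_(x in D) (g x + (2 * eta)%:E))%E.
    have tE : trivIset [set: nat] E.
      apply/trivIsetP => i j _ _; wlog ij : i j / (i < j)%N.
        move=> h; rewrite neq_ltn => /orP[] lt; [|rewrite setIC]; apply: h => //.
          by rewrite ltn_eqF.
        by rewrite ltn_eqF.
      move=> _; apply/seteqP; split => // x [[_ /=]]; rewrite in_itv/= => /andP[_ gi] [_ /=].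
      rewrite in_itv/= => /andP[gj _]; have := le_lt_trans gj gi.
      by rewrite lte_fin ltr_pM2r// ltr_nat ltnS leqNgt ij.
    apply: (@le_trans _ _ (\int[leb]_(x in \bigcup_k E k) (g x + (2 * eta)%:E))%E); last first.
      apply: ge0_subset_integral => //.
      - exact: bigcupT_measurable.
      - exact: emeasurable_funD.
      - by move=> x Dx; rewrite adde_ge0 ?g0// lee_fin mulr_ge0// ltW.
      - by move=> x [k _ []].
    have ED : \bigcup_k E k `<=` D by move=> x [k _ []].
    rewrite ge0_integral_bigcup//; last 2 first.
      - apply: emeasurable_funD => //; apply: measurable_funS mg => //.
      - by move=> x /ED Dx; rewrite adde_ge0 ?g0// lee_fin mulr_ge0// ltW.
    apply: lee_nneseries => k _; first by move=> _; rewrite mule_ge0// lee_fin ltW.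
    rewrite -integral_cst//; apply: ge0_le_integral => //.
    - by move=> x _; rewrite lee_fin ltW.
    - by apply: emeasurable_funD => //; apply: measurable_funS mg => //; move=> x [].
    move=> x [_ /=]; rewrite in_itv/= => /andP[gk _].
    rewrite /c -addn2 natrD mulrDl EFinD leeD2r//.
  apply: le_trans (leeD2r _ gE) _.
  rewrite ge0_integralD//; last by move=> x _; rewrite lee_fin mulr_ge0// ltW.
  rewrite integral_cst//= lDr -EFinM -addeA leeD2l// -EFinD lee_fin.
move=> x r Dx rg.
(* For finite [g x] the index is the level of [x]; for infinite [g x] any index with [r < c k] will
   do. *)
have [k [xA rc]] : exists k, (E k `|` Eoo) x /\ r < c k.
  move: rg; have := g0 x Dx; case gx : (g x) => [v| |] //.
    rewrite !lee_fin => v0 rv; exists (Num.truncn (v / eta)).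
    have /truncn_itv/andP[t1 t2] : 0 <= v / eta by rewrite divr_ge0// ltW.
    split; first left; last first.
      rewrite (le_lt_trans rv)// /c -ltr_pdivrMr// (lt_trans t2)// ltr_nat.
      by rewrite ltnS.
    split => //=; rewrite gx in_itv/= lee_fin lte_fin -ler_pdivlMr// t1/=.
    by rewrite -ltr_pdivrMr.
  move=> _ _; exists (Num.truncn (Num.max 0 r / eta)).
  have /truncn_itv/andP[_ t2] : 0 <= Num.max 0 r / eta by rewrite divr_ge0// ?le_max ?lexx// ltW.
  split; first by right.
  rewrite (@le_lt_trans _ _ (Num.max 0 r)) ?le_max ?lexx ?orbT//.
  by rewrite /c -ltr_pdivrMr// (lt_trans t2)// ltr_nat ltnS.
exists (c k), (U k); split => //; [exact: ltW|exact: AU|].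
move=> y Uy; rewrite /w (@nneseriesD1 _ _ k)//.
rewrite indicE mem_set// mule1 leeDl//; apply: nneseries_ge0 => *; exact: w10.
Qed.

(** The point [x] is one end of the interval, on either side, which is the form of the step in
    [real_induction]. *)
Lemma derive_growth (phi : R -> R) (x l K : R) : is_derive x 1 phi l -> l < K ->
  exists2 e, 0 < e & forall y z, y <= z -> (y = x \/ z = x) -> z - y < e ->
    phi z - phi y <= K * (z - y).
Proof.
move=> [dx <-] lK.
have : (fun h => h^-1 *: (phi (h *: 1 + x) - phi x)) @ 0^' --> 'D_1 phi x by [].
move=> /(_ [set v | v < K]) /=.
have nK : nbhs ('D_1 phi x) [set v | v < K] by exact: lt_nbhsl.
move=> /(_ nK) /nbhs_ballP[e e0 he]; exists e => // y z yz xyz zye.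
have [->|nyz] := eqVneq y z; first by rewrite !subrr mulr0.
have zy : 0 < z - y by rewrite subr_gt0 lt_neqAle nyz.
rewrite -ler_pdivrMr//; apply: ltW; case: xyz => xE.
  have /= := he (z - y); rewrite /ball/= sub0r normrN gtr0_norm//.
  move=> /(_ zye); rewrite gt_eqF// => /(_ isT).
  by rewrite /GRing.scale/= mulr1 -xE subrK mulrC.
have yz0 : y - z < 0 by rewrite -opprB oppr_lt0.
have /= := he (y - z); rewrite /ball/= sub0r normrN ltr0_norm//.
rewrite opprB => /(_ zye); rewrite lt_eqF// => /(_ isT).
rewrite /GRing.scale/= mulr1 -xE subrK mulrC.
by rewrite -mulrNN -invrN !opprB.
Qed.

(** If the integral of [g] is finite, [g] is replaced by the weight [w] of [open_weight], at a cost
    [e]. Continuous induction then shows that [phi y - phi a] stays below the integral of [w] up to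
    [y]. *)
Lemma ftc_le (phi f : R -> R) (g : RR -> \bar R) (a b : R) : a <= b ->
  measurable_fun (`[a, b]%classic : set RR) g -> (forall x, (0 <= g x)%E) ->
  (forall x : R, a <= x <= b -> is_derive x 1 phi (f x) /\ ((f x)%:E <= g x)%E) ->
  ((phi b - phi a)%:E <= \int[leb]_(x in `[a, b]) g x)%E.
Proof.
move=> ab mg g0 hf; set D : set RR := `[a, b]%classic.
have [->|Ioo] := eqVneq (\int[leb]_(x in D) g x)%E +oo%E; first by rewrite leey.
have mD : measurable (D : set RR) by exact: measurable_itv.
have lD : (leb D < +oo)%E by rewrite lebesgue_measure_itv/=; case: ifP; rewrite ?ltry.
have ig : leb.-integrable D g.
  apply/integrableP; split => //; under eq_integral do rewrite gee0_abs//.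
  by rewrite ltey.
apply/lee_addgt0Pr => e e0.
have [w [mw w0 wle hw]] := open_weight mD lD ig (fun x _ => g0 x) e0.
apply: le_trans wle.
pose W y := (\int[leb]_(x in `[a, y]) w x)%E.
rewrite -/(W b).
(* Near [x], [phi] grows with slope at most [c], and [w] is at least [c]. *)
apply: (@real_induction (fun y => (phi y - phi a)%:E <= W y)%E a b ab).
  by rewrite subrr; apply: integral_ge0.
move=> x axb; have [dx fg] := hf x axb.
have Dx : D x by rewrite /D/= in_itv.
have [c [U [fc c0 oU Ux Uw]]] := hw x (f x) Dx fg.
have [e1 e10 he1] := derive_growth dx fc.
have /nbhs_ballP[e2 e20 e2U] : nbhs x U by exact: open_nbhs_nbhs.
exists (Num.min e1 e2); first by rewrite lt_min e10.
move=> y z ay yz zb xyz; rewrite lt_min => /andP[zy1 zy2] Qy.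
have -> : W z = (W y + \int[leb]_(x in `]y, z]) w x)%E.
  rewrite /W -ge0_integral_setU//=.
  - congr integral; apply/seteqP; split => t /=; rewrite !in_itv/=.
      move=> /andP[at_ tz]; rewrite at_ tz andbT /=.
      by have [ty|ty] := leP t y; [left|right].
    move=> [/andP[-> ty]|/andP[yt ->]]; first by rewrite (le_trans ty).
    by rewrite andbT (le_trans ay)// ltW.
  - exact: measurable_funTS.
  - rewrite disj_set2E; apply/eqP/seteqP; split => // t /=; rewrite !in_itv/=.
    by move=> [/andP[_ ty] /andP[+ _]]; rewrite ltNge ty.
rewrite -(subrK (phi y) (phi z)) -addrA addrC EFinD leeD//.
apply: (@le_trans _ _ (c * (z - y))%:E); first by rewrite lee_fin he1.
have -> : (c * (z - y))%:E = (\int[leb]_(x in `]y, z]) (cst c%:E) x)%E.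
  rewrite integral_cst//= lebesgue_measure_itv/= lte_fin.
  case: ltP => [_|zy]; first by rewrite -EFinB -EFinM.
  by have -> : y = z by [apply/le_anti/andP]; rewrite subrr mulr0 mule0.
apply: ge0_le_integral => //=; first exact: measurable_funTS.
move=> t; rewrite /= in_itv/= => /andP[yt tz]; apply: Uw; apply: e2U.
rewrite /ball/=; apply: le_lt_trans zy2.
case: xyz => <-; first by rewrite ltr0_norm ?subr_lt0// opprB lerB.
by rewrite ger0_norm ?subr_ge0// lerB// ltW.
Qed.

End FTC.

(** * Increments of a function over a box, bounded by integrals of its mixed derivative *)

Section BoxIncrement.
Context {R : realType} {d : nat} (a b : R).
Local Notation V := 'rV[R]_d.
Implicit Types (x y : V) (s : seq 'I_d) (F : V -> R).

Definition bdiff1 i F x : R := F (upd x i b) - F (upd x i a).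

Definition bdiff s F : V -> R := foldl (fun G i => bdiff1 i G) F s.

Lemma bdiff_rcons s i F : bdiff (rcons s i) F = bdiff1 i (bdiff s F).
Proof. by rewrite /bdiff foldl_rcons. Qed.

Lemma upd_comm x i j (t u : R) : i != j -> upd (upd x i t) j u = upd (upd x j u) i t.
Proof.
move=> ij; apply/rowP => k; rewrite !mxE.
by have [->|//] := eqVneq k j; rewrite eq_sym (negPf ij).
Qed.

Lemma upd_shift x i (t h : R) : upd x i (t + h) = upd x i t + h *: dir i.
Proof.
apply/rowP => k; rewrite !mxE eqxx /=.
by case: eqP => _; rewrite ?mulr1 ?mulr0 ?addr0.
Qed.

Lemma vlt_upd x i (t : R) : vlt x (const_mx 0) -> t < 0 -> vlt (upd x i t) (const_mx 0).
Proof. by move=> x0 t0 j; have := x0 j; rewrite !mxE; case: eqP. Qed.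

Lemma has_partial_near s i F x : has_partial (i :: s) F x -> has_partial s F x.
Proof. by move=> [/nbhs_singleton + _]; rewrite scale0r addr0. Qed.

Lemma partial_rcons s i F : partial (rcons s i) F = partial s (fun x => 'D_(dir i) F x).
Proof. by elim: s => //= j s ->. Qed.

Lemma has_partial_rcons s i F x : has_partial (rcons s i) F x ->
  derivable F x (dir i) /\ has_partial s (fun x => 'D_(dir i) F x) x.
Proof.
elim: s x => [|j s IH] x /=; first by move=> [].
move=> h; have [dF hs] := IH x (has_partial_near h); split=> //.
case: h => nx dx; split; last by rewrite -partial_rcons.
by apply: filterS nx => t /IH[].
Qed.

Lemma is_derive_upd F x i (t : R) : derivable F (upd x i t) (dir i) ->
  is_derive t 1 (fun u => F (upd x i u)) ('D_(dir i) F (upd x i t)).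
Proof.
move=> dF.
have E : (fun h : R => h^-1 *: (F (upd x i (h *: 1 + t)) - F (upd x i t))) =
         (fun h => h^-1 *: (F (h *: dir i + upd x i t) - F (upd x i t))).
  apply/funext => h; congr (_ *: (F _ - _)).
  by rewrite [h *: 1]mulr1 addrC upd_shift addrC.
split; first by rewrite /derivable /= E.
by rewrite /derive /= E.
Qed.

(** Updates at different coordinates commute, so differentiation in direction [i] passes through the
    differences in the directions of [s]. *)
Lemma is_derive_bdiff s F i x (t : R) : a < 0 -> b < 0 -> i \notin s ->
  (forall y, vlt y (const_mx 0) -> derivable F y (dir i)) ->
  vlt x (const_mx 0) -> t < 0 ->
  is_derive t 1 (fun u => bdiff s F (upd x i u))
    (bdiff s (fun y => 'D_(dir i) F y) (upd x i t)).
Proof.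
move=> a0 b0; elim/last_ind: s x => [|s j IH] x.
  by move=> _ dF x0 t0; apply: is_derive_upd; apply: dF; exact: vlt_upd.
rewrite mem_rcons inE negb_or => /andP[ij is_] dF x0 t0.
rewrite !bdiff_rcons /bdiff1 !(upd_comm _ _ _ ij).
under [X in is_derive _ _ X]eq_fun do rewrite !(upd_comm _ _ _ ij).
by apply: is_deriveB; apply: IH => //; exact: vlt_upd.
Qed.

(** Induction from the end of the list: its last index carries the innermost derivative but the
    outermost difference and integral. [ftc_le] treats that coordinate, and the induction hypothesis
    is applied to the derivative of [F] in its direction. *)
Lemma bdiff_le_intn s F (f : V -> \bar R) x : a <= b -> b < 0 -> uniq s ->
  (forall y, vlt y (const_mx 0) -> has_partial s F y) ->
  measurable_fun [set: borelRV R d] f -> (forall y, 0 <= f y)%E ->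
  (forall y, vlt y (const_mx 0) -> ((partial s F y)%:E <= f y)%E) ->
  vlt x (const_mx 0) ->
  ((bdiff s F x)%:E <= intn `[a, b]%classic s f x)%E.
Proof.
move=> ab b0; have a0 := le_lt_trans ab b0.
elim/last_ind: s F x => [|s i IH] F x; first by move=> _ _ _ _ Ff x0; exact: Ff.
rewrite rcons_uniq => /andP[is_ us] hF mf f0 Ff x0.
rewrite bdiff_rcons /intn foldl_rcons -/(intn _ s f) /int1.
have mD : measurable (`[a, b]%classic : set R) by exact: measurable_itv.
apply: (@ftc_le R (fun t => bdiff s F (upd x i t))
   (fun t => bdiff s (fun y => 'D_(dir i) F y) (upd x i t))) => //.
- by apply: measurable_upd2D; exact: measurable_intn.
- by move=> t; exact: intn_ge0.
move=> t /andP[at_ tb]; have t0 := le_lt_trans tb b0; split.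
  apply: is_derive_bdiff => //.
  by move=> y y0; have [] := has_partial_rcons (hF y y0).
apply: IH => //; last exact: vlt_upd.
- by move=> y y0; have [] := has_partial_rcons (hF y y0).
- by move=> y y0; rewrite -partial_rcons; exact: Ff.
Qed.

Lemma bdiff_df (mu : {finite_measure set (borelRV R d) -> \bar R}) s x : a <= b ->
  uniq s ->
  bdiff s (df mu) x = fine (mu [set z : V | forall j,
    if j \in s then a < z 0 j <= b else z 0 j <= x 0 j]).
Proof.
move=> ab; pose B s x := [set z : V | forall j,
    if j \in s then a < z 0 j <= b else z 0 j <= x 0 j].
have mB r y : measurable (B r y : set (borelRV R d)).
  have -> : B r y = \bigcap_(j in [set: 'I_d]) ((fun z : borelRV R d => (z : V) 0 j) @^-1`
      (if j \in r then `]a, b]%classic else `]-oo, y 0 j]%classic)).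
    by apply/seteqP; split => [z h j _|z h j]; [have := h j|have := h j I];
       case: ifP; rewrite /= in_itv.
  apply: fin_bigcap_measurable; first exact: finite_finset.
  move=> j _; rewrite -[X in measurable X]setTI; apply: measurable_coord => //.
  by case: ifP => _; exact: measurable_itv.
rewrite -/(B s x); elim/last_ind: s x => [|s i IH] x.
  by move=> _; congr (fine (mu _)).
rewrite rcons_uniq => /andP[is_ us]; rewrite bdiff_rcons /bdiff1 !IH//.
have sub : B s (upd x i a) `<=` B s (upd x i b).
  move=> z h j; have := h j; case: ifP => // _; rewrite !mxE; case: eqP => // _.
  by move=> /le_trans; exact.
have -> : B (rcons s i) x = B s (upd x i b) `\` B s (upd x i a).
  apply/seteqP; split => z.
    move=> h; split.
      move=> j; have := h j; rewrite mem_rcons inE mxE.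
      have [->|_] := eqVneq j i; last by [].
      by rewrite (negPf is_) => /andP[].
    move=> /(_ i); rewrite (negPf is_) upd_eq.
    by have := h i; rewrite mem_rcons mem_head ltNge => /andP[/negPf ->].
  move=> [h1 h2] j; rewrite mem_rcons inE; have := h1 j; rewrite mxE.
  have [->|_] := eqVneq j i; last by [].
  rewrite (negPf is_) => zb /=; rewrite zb andbT ltNge; apply/negP => za.
  apply: h2 => k; have := h1 k; case: ifP => // _; rewrite !mxE.
  by case: eqP => [->|].
rewrite measureD//; last by rewrite ltey_eq fin_num_measure//; exact: mB.
by rewrite (setIidr sub) fineB// fin_num_measure//; exact: mB.
Qed.

End BoxIncrement.

(** * Mixed partial derivatives of a composition *)

Section FaaDiBruno.
Context {R : realType} {d : nat}.
Local Notation V := 'rV[R]_d.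
Implicit Types (x : V) (s r : seq 'I_d) (c f g : V -> R) (B : seq 'I_d)
  (Bs : seq (seq 'I_d)).

(** The reduction to one variable gives access to the chain rule and to the invariance of
    derivatives under equality near a point. *)
Lemma is_derive_lineP f x (v : V) (l : R) :
  is_derive x v f l <-> is_derive (0 : R) 1 (fun t : R => f (x + t *: v)) l.
Proof.
have E : (fun h : R => h^-1 *: (f (x + (h *: 1 + 0) *: v) - f (x + 0 *: v))) =
         (fun h => h^-1 *: (f (h *: v + x) - f x)).
  by apply/funext => h; rewrite scale0r !addr0 [h *: 1]mulr1 [x + _]addrC.
have Ed : derivable (fun t : R => f (x + t *: v)) (0 : R) 1 = derivable f x v.
  by rewrite /derivable /= E.
have ED : 'D_1 (fun t : R => f (x + t *: v)) (0 : R) = 'D_v f x.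
  by rewrite /derive /= E.
by split=> -[df <-]; (split; [rewrite ?Ed// -Ed|rewrite ?ED]).
Qed.

Lemma near_line_is_derive f g x (v : V) (l : R) :
  (\forall t \near (0 : R), g (x + t *: v) = f (x + t *: v)) ->
  is_derive x v f l -> is_derive x v g l.
Proof.
move=> fg /is_derive_lineP df; apply/is_derive_lineP.
by apply: near_eq_is_derive df; apply: filterS fg => t.
Qed.

Lemma is_derive_comp_dir (h : R -> R) c x (v : V) (a b : R) :
  is_derive (c x) 1 h a -> is_derive x v c b -> is_derive x v (fun y => h (c y)) (a * b).
Proof.
move=> dh /is_derive_lineP dc; apply/is_derive_lineP.
apply: (@is_derive1_comp R h (fun t : R => c (x + t *: v))) => //.
by rewrite scale0r addr0.
Qed.

(** The product rule: each resulting list of blocks has the new index [i] put in front of one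
    block. *)
Fixpoint leibniz (i : 'I_d) Bs : seq (seq (seq 'I_d)) :=
  if Bs is B :: Bs' then ((i :: B) :: Bs') :: map (cons B) (leibniz i Bs') else [::].

(* A pair [(k, [:: B1; ...; Bm])] stands for the summand
   [phi^(k)(c) * d_B1 c * ... * d_Bm c] of the expansion of d_s (phi o c). *)
Definition faa_step (i : 'I_d) (t : nat * seq (seq 'I_d)) :=
  (t.1.+1, [:: i] :: t.2) :: [seq (t.1, Bs) | Bs <- leibniz i t.2].

Fixpoint faa s : seq (nat * seq (seq 'I_d)) :=
  if s is i :: s' then flatten [seq faa_step i t | t <- faa s'] else [:: (0%N, [::])].

Definition block_prod c Bs x : R := \prod_(B <- Bs) partial B c x.

Definition faa_term (phi : nat -> R -> R) c t x : R :=
  phi t.1 (c x) * block_prod c t.2 x.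

Definition has_all_partial s c x := forall r, subseq r s -> has_partial r c x.

(** Hence the expansion involves only derivatives along subsequences of [s]. When [s] has distinct
    entries these are derivatives in distinct directions, as in condition (ii). *)
Lemma faa_blocks s t : t \in faa s -> all (fun B => subseq B s) t.2.
Proof.
elim: s t => [t|i s IH t /= /flatten_mapP[u /IH us]]; first by rewrite inE => /eqP ->.
have sub Bs : all (fun B => subseq B s) Bs -> all (fun B => subseq B (i :: s)) Bs.
  by apply: sub_all => B /subseq_trans; apply; exact: subseq_cons.
rewrite inE => /predU1P[-> |/mapP[Bs + ->]].
  by rewrite /= eqxx sub0seq -/(subseq _ _) sub.
elim: (u.2) us Bs => // B Bs IHB /andP[PB PBs] Cs /=.
rewrite inE => /predU1P[->|/mapP[Ds Dl ->]] /=.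
  by rewrite eqxx PB sub.
  by apply/andP; split; [exact: subseq_trans PB (subseq_cons _ _)|exact: IHB].
Qed.

(** Subsequences are given by finitely many bit masks, so finitely many neighbourhoods are
    intersected. *)
Lemma has_all_partial_near i s c x : has_all_partial (i :: s) c x ->
  \forall t \near (0 : R), has_all_partial s c (x + t *: dir i).
Proof.
move=> h; have : \forall t \near (0 : R), forall m : (size s).-tuple bool,
    has_partial (mask m s) c (x + t *: dir i).
  apply: (@filter_forall _ _ (fun (m : (size s).-tuple bool) t =>
    has_partial (mask m s) c (x + t *: dir i)) (nbhs (0 : R))) => m.
  have [] // : has_partial (i :: mask m s) c x.
  by apply: h; rewrite /= eqxx mask_subseq.
apply: filterS => t ht r /subseqP[m /eqP ms ->]; exact: (ht (Tuple ms)).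
Qed.

Lemma is_derive_partial i r c x : has_partial (i :: r) c x ->
  is_derive x (dir i) (partial r c) (partial (i :: r) c x).
Proof. by move=> [_ h]; split. Qed.

Lemma is_derive_block_prod i Bs c x :
  (forall B, B \in Bs -> has_partial (i :: B) c x) ->
  is_derive x (dir i) (block_prod c Bs) (\sum_(Cs <- leibniz i Bs) block_prod c Cs x).
Proof.
elim: Bs => [|B Bs IH] h /=.
  have -> : block_prod c [::] = fun=> 1 by apply/funext => y; rewrite /block_prod big_nil.
  by rewrite big_nil; exact: is_derive_cst.
have -> : block_prod c (B :: Bs) = partial B c * block_prod c Bs.
  by apply/funext => y; rewrite /block_prod big_cons.
apply: (@is_derive_eq _ _ _ _ _ _ _ _ (is_deriveM (is_derive_partial (h B (mem_head _ _))) (IH _))).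
  by move=> C CB; apply: h; rewrite in_cons CB orbT.
rewrite big_cons big_map /GRing.scale/= addrC; congr (_ + _).
  by rewrite /block_prod big_cons mulrC.
rewrite mulr_sumr; apply: eq_bigr => Cs _.
by rewrite /block_prod big_cons.
Qed.

Lemma is_derive_faa_term (phi : nat -> R -> R) i c t x :
  (forall k (u : R), is_derive u 1 (phi k) (phi k.+1 u)) ->
  derivable c x (dir i) ->
  (forall B, B \in t.2 -> has_partial (i :: B) c x) ->
  is_derive x (dir i) (faa_term phi c t) (\sum_(u <- faa_step i t) faa_term phi c u x).
Proof.
move=> dphi dc h.
have dc' : is_derive x (dir i) c (partial [:: i] c x) by split.
have -> : faa_term phi c t = (fun y => phi t.1 (c y)) * block_prod c t.2.
  by apply/funext => y.
apply: (@is_derive_eq _ _ _ _ _ _ _ _ (is_deriveM (is_derive_comp_dir (dphi t.1 (c x)) dc')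
  (is_derive_block_prod h))).
rewrite big_cons big_map /GRing.scale/= addrC; congr (_ + _).
  by rewrite /faa_term /block_prod big_cons /= mulrC mulrA.
by rewrite mulr_sumr.
Qed.

(** By induction the expansion for the tail of [s] holds near [x] along direction [i], not only at
    [x], so it can be differentiated term by term. *)
Lemma faa_di_bruno (phi : nat -> R -> R) s c x :
  (forall k (u : R), is_derive u 1 (phi k) (phi k.+1 u)) -> has_all_partial s c x ->
  has_partial s (fun y => phi 0%N (c y)) x /\
  partial s (fun y => phi 0%N (c y)) x = \sum_(t <- faa s) faa_term phi c t x.
Proof.
move=> dphi; elim: s x => [|i s IH] x hs.
  by split=> //=; rewrite big_seq1 /faa_term /block_prod big_nil mulr1.
have dsum : is_derive x (dir i) (fun y => \sum_(t <- faa s) faa_term phi c t y)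
    (\sum_(t <- faa s) \sum_(u <- faa_step i t) faa_term phi c u x).
  have dt t : t \in faa s -> is_derive x (dir i) (faa_term phi c t)
      (\sum_(u <- faa_step i t) faa_term phi c u x).
    move=> tf; apply: is_derive_faa_term => //.
      by have [] : has_partial [:: i] c x by apply: hs; rewrite /= eqxx sub0seq.
    move=> B Bt; apply: hs; rewrite /= eqxx.
    exact: (allP (faa_blocks tf)).
  elim: (faa s) dt => [_|t l IHl dt].
    by rewrite big_nil; under eq_fun do rewrite big_nil; exact: is_derive_cst.
  rewrite big_cons; under eq_fun do rewrite big_cons.
  apply: is_deriveD; first by apply: dt; rewrite mem_head.
  by apply: IHl => u ul; apply: dt; rewrite in_cons ul orbT.
have near_s : \forall t \near (0 : R), has_all_partial s c (x + t *: dir i).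
  exact: has_all_partial_near.
have [dF DF] : is_derive x (dir i) (partial s (fun y => phi 0%N (c y)))
    (\sum_(t <- faa s) \sum_(u <- faa_step i t) faa_term phi c u x).
  apply: near_line_is_derive dsum; apply: filterS near_s => t /IH[_ ->//].
split; first by split=> //; apply: filterS near_s => t /IH[].
by rewrite /= DF /= big_flatten big_map.
Qed.

Lemma cvg_sum_in (I : eqType) (f : I -> nat -> R) (a : I -> R) (l : seq I) :
  (forall t, t \in l -> f t @ \oo --> a t) ->
  (fun n => \sum_(t <- l) f t n) @ \oo --> \sum_(t <- l) a t.
Proof.
elim: l => [_|t l IH h].
  rewrite big_nil (_ : (fun n => _) = cst 0); first exact: cvg_cst.
  by apply/funext => n; rewrite big_nil.
rewrite big_cons (_ : (fun n => _) = (fun n => f t n + \sum_(u <- l) f u n)).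
  apply: cvgD; first by apply: h; rewrite mem_head.
  by apply: IH => u ul; apply: h; rewrite in_cons ul orbT.
by apply/funext => n; rewrite big_cons.
Qed.

Lemma cvg_prod_in (I : eqType) (f : I -> nat -> R) (a : I -> R) (l : seq I) :
  (forall t, t \in l -> f t @ \oo --> a t) ->
  (fun n => \prod_(t <- l) f t n) @ \oo --> \prod_(t <- l) a t.
Proof.
elim: l => [_|t l IH h].
  rewrite big_nil (_ : (fun n => _) = cst 1); first exact: cvg_cst.
  by apply/funext => n; rewrite big_nil.
rewrite big_cons (_ : (fun n => _) = (fun n => f t n * \prod_(u <- l) f u n)).
  apply: cvgM; first by apply: h; rewrite mem_head.
  by apply: IH => u ul; apply: h; rewrite in_cons ul orbT.
by apply/funext => n; rewrite big_cons.
Qed.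

(** Both sides expand over the same finite list [faa s], which does not depend on [n], and each term
    converges factor by factor. *)
Lemma cvg_partial_comp (phin : nat -> nat -> R -> R) (phi : nat -> R -> R)
    (cn : nat -> V -> R) c s x :
  (forall n k (u : R), is_derive u 1 (phin n k) (phin n k.+1 u)) ->
  (forall k (u : R), is_derive u 1 (phi k) (phi k.+1 u)) ->
  (forall k, phin n k (cn n x) @[n --> \oo] --> phi k (c x)) ->
  has_all_partial s c x ->
  (forall r, subseq r s -> (\forall n \near \oo, has_partial r (cn n) x) /\
     partial r (cn n) x @[n --> \oo] --> partial r c x) ->
  (\forall n \near \oo, has_partial s (fun y => phin n 0%N (cn n y)) x) /\
  partial s (fun y => phin n 0%N (cn n y)) x @[n --> \oo] -->
    partial s (fun y => phi 0%N (c y)) x.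
Proof.
move=> dphin dphi cvphi hc hcn.
have near_all : \forall n \near \oo, has_all_partial s (cn n) x.
  have : \forall n \near \oo, forall m : (size s).-tuple bool,
      has_partial (mask m s) (cn n) x.
    apply: (@filter_forall _ _ (fun (m : (size s).-tuple bool) n =>
      has_partial (mask m s) (cn n) x) \oo) => m.
    by case: (hcn _ (mask_subseq m s)).
  by apply: filterS => t ht r /subseqP[m /eqP ms ->]; exact: (ht (Tuple ms)).
split; first by apply: filterS near_all => n /(faa_di_bruno (dphin n))[].
rewrite (faa_di_bruno dphi hc).2.
apply: (@cvg_trans _ (\sum_(t <- faa s) faa_term (phin n) (cn n) t x @[n --> \oo])).
  apply: (@near_eq_cvg _ _ \oo).
  apply: (filterS _ near_all) => n hn /=.
  by rewrite (faa_di_bruno (dphin n) hn).2.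
apply: (@cvg_sum_in _ (fun t n => faa_term (phin n) (cn n) t x)) => t tf.
apply: cvgM; first exact: cvphi.
apply: (@cvg_prod_in _ (fun B n => partial B (cn n) x)) => B Bt.
by have [] := hcn B (allP (faa_blocks tf) B Bt).
Qed.

End FaaDiBruno.

(** * Convergence of the derivatives of [(1 + t / n) ^ n] to the exponential *)

Section ExpLimit.
Context {R : realType}.

(* The [k]-th derivative of [t |-> (1 + t / n) ^ n]. *)
Definition powd n k (t : R) : R :=
  (n ^_ k)%:R * n%:R^-1 ^+ k * (1 + n%:R^-1 * t) ^+ (n - k).

Lemma is_derive_powd n k (t : R) : is_derive t 1 (powd n k) (powd n k.+1 t).
Proof.
have da : is_derive t 1 (fun u : R => 1 + n%:R^-1 * u) n%:R^-1.
  have := is_deriveD (is_derive_cst (1 : R) t (1 : R))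
    (is_deriveZ n%:R^-1 (is_derive_id t (1 : R))).
  by move/is_derive_eq; apply; rewrite add0r [_ *: 1]mulr1.
have -> : powd n k = ((n ^_ k)%:R * n%:R^-1 ^+ k) \*: ((fun u : R => 1 + n%:R^-1 * u) ^+ (n - k)).
  by apply/funext => u; rewrite /powd /= fctE.
have := is_deriveZ ((n ^_ k)%:R * n%:R^-1 ^+ k) (is_deriveX (n - k) da).
move/is_derive_eq; apply.
rewrite /GRing.scale/= /powd ffactnSr natrM exprSr subnS ; ring.
Qed.

Lemma bernoulli_le (h : R) m : 0 <= h <= 1 -> 1 - m%:R * h <= (1 - h) ^+ m.
Proof.
move=> /andP[h0 h1]; elim: m => [|m IH]; first by rewrite mul0r subr0 expr0.
apply: (@le_trans _ _ ((1 - h) * (1 - m%:R * h))).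
  rewrite -natr1 -subr_ge0.
  have -> : (1 - h) * (1 - m%:R * h) - (1 - (m%:R + 1) * h) = m%:R * h ^+ 2 by ring.
  by rewrite mulr_ge0// exprn_ge0.
by rewrite exprS ler_wpM2l// subr_ge0.
Qed.

(** With [v = u n / n] and [|v| < 1], one has [(1 - v ^ 2) * exp v <= 1 + v <= exp v]. Taking [n]-th
    powers and using Bernoulli's inequality squeezes the sequence between
    [(1 - u n ^ 2 / n) * exp (u n)] and [exp (u n)]. *)
Lemma cvg_exp_pow (u : nat -> R) (t : R) : u @ \oo --> t ->
  (fun n => (1 + n%:R^-1 * u n) ^+ n) @ \oo --> expR t.
Proof.
move=> ut.
have inv0 : (fun n : nat => n%:R^-1 : R) @ \oo --> (0 : R).
  by rewrite -cvg_shiftS; exact: cvg_harmonic.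
have v0 : (fun n => n%:R^-1 * u n) @ \oo --> (0 : R).
  by rewrite -(mul0r t); exact: cvgM.
have w0 : (fun n => n%:R^-1 * (u n * u n)) @ \oo --> (0 : R).
  by rewrite -(mul0r (t * t)); apply: cvgM => //; exact: cvgM.
have eu : (fun n => expR (u n)) @ \oo --> expR t.
  by apply: continuous_cvg => //; exact: continuous_expR.
apply: (@squeeze_cvgr _ _ _ _ (fun n => (1 - n%:R^-1 * (u n * u n)) * expR (u n))
   (fun n => expR (u n))) => //; last first.
  rewrite -[X in _ --> X](mul1r (expR t)); apply: cvgM => //.
  by rewrite -[X in _ --> X](subr0 1); apply: cvgB => //; exact: cvg_cst.
have near1 : \forall n \near \oo, `|n%:R^-1 * u n| < 1.
  by move/cvgrPdist_lt : v0 => /(_ 1 ltr01); apply: filterS => n; rewrite sub0r normrN.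
have ngt0 : \forall n \near \oo, (0 < n)%N by exact: nbhs_infty_gt.
apply: filterS2 near1 ngt0 => n; set v := n%:R^-1 * u n => v1 n0.
have n0' : n%:R != 0 :> R by rewrite pnatr_eq0 -lt0n.
have unv : u n = n%:R * v by rewrite /v mulrA mulfV// mul1r.
have [vN v1'] : -1 < v /\ v < 1 by apply/andP; rewrite -ltr_norml.
rewrite unv expRM_natl; apply/andP; split; last first.
  by apply: lerXn2r; rewrite ?nnegrE ?expR_ge0// ?expR_ge1Dx//; lra.
have -> : n%:R^-1 * (n%:R * v * (n%:R * v)) = n%:R * v ^+ 2 by field.
have v2 : 0 <= v ^+ 2 <= 1.
  by rewrite sqr_ge0 -real_normK ?num_real// expr_le1// ltW.
apply: (@le_trans _ _ ((1 - v ^+ 2) ^+ n * expR v ^+ n)).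
  by rewrite ler_wpM2r ?exprn_ge0 ?expR_ge0// bernoulli_le.
have v20 : 0 <= 1 - v ^+ 2 by rewrite subr_ge0; case/andP: v2.
rewrite -exprMn lerXn2r ?nnegrE ?mulr_ge0 ?expR_ge0//; first by lra.
have -> : 1 - v ^+ 2 = (1 + v) * (1 - v) by ring.
rewrite -mulrA -[leRHS]mulr1 ler_wpM2l//; first by lra.
have := expR_ge1Dx (- v); rewrite expRN -ler_pdivlMr ?expR_gt0// => h.
by rewrite div1r.
Qed.

(** For fixed [k] the factor [n ^_ k / n ^ k] tends to 1, and so does the [k]-th power of
    [1 + u n / n] by which exponents [n] and [n - k] differ. *)
Lemma cvg_powd (u : nat -> R) (t : R) k : u @ \oo --> t ->
  (fun n => powd n k (u n)) @ \oo --> expR t.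
Proof.
move=> ut.
have inv0 : (fun n : nat => n%:R^-1 : R) @ \oo --> (0 : R).
  by rewrite -cvg_shiftS; exact: cvg_harmonic.
have base1 : (fun n => 1 + n%:R^-1 * u n) @ \oo --> (1 : R).
  have E : 1 + 0 * t = 1 by rewrite mul0r addr0.
  rewrite -[X in _ --> X]E.
  by apply: cvgD; [exact: cvg_cst|exact: cvgM].
have basek : (fun n => (1 + n%:R^-1 * u n) ^+ k) @ \oo --> (1 : R).
  elim: k => [|k IH]; first exact: cvg_cst.
  rewrite -[X in _ --> X](mulr1 1).
  under eq_fun do rewrite exprS.
  exact: cvgM.
have fall1 : (fun n => (n ^_ k)%:R * n%:R^-1 ^+ k) @ \oo --> (1 : R).
  elim: k {basek} => [|k IH].
    under eq_fun do rewrite ffactn0 expr0 mulr1.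
    exact: cvg_cst.
  have L : (fun n : nat => ((n ^_ k)%:R * n%:R^-1 ^+ k) * (1 - k%:R * n%:R^-1)) @ \oo --> (1 : R).
    have E : 1 * (1 - k%:R * 0) = 1 :> R by rewrite mulr0 subr0 mulr1.
    rewrite -[X in _ --> X]E; apply: cvgM => //.
    by apply: cvgB; [exact: cvg_cst|apply: cvgM => //; exact: cvg_cst].
  apply: cvg_trans L; apply: near_eq_cvg; near=> n.
  have n0 : (0 < n)%N by near: n; exact: nbhs_infty_gt.
  have kn : (k <= n)%N by near: n; exact: nbhs_infty_ge.
  have nR : n%:R != 0 :> R by rewrite pnatr_eq0 -lt0n.
  by rewrite ffactnSr natrM exprSr natrB//; field.
have L : (fun n => ((n ^_ k)%:R * n%:R^-1 ^+ k) *
    ((1 + n%:R^-1 * u n) ^+ n * ((1 + n%:R^-1 * u n) ^+ k)^-1)) @ \oo --> expR t.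
  have E : 1 * (expR t * 1^-1) = expR t by rewrite invr1 mulr1 mul1r.
  rewrite -[X in _ --> X]E; apply: cvgM => //.
  apply: cvgM; first exact: cvg_exp_pow.
  by apply: cvgV => //; exact: oner_neq0.
apply: cvg_trans L; apply: near_eq_cvg; near=> n.
have kn : (k <= n)%N by near: n; exact: nbhs_infty_ge.
have b0 : 1 + n%:R^-1 * u n != 0.
  rewrite gt_eqF//; near: n.
  exact: (cvgr_gt _ base1 _ ltr01).
rewrite /powd; move: b0; set c := 1 + _ => b0; congr (_ * _).
have -> : c ^+ n = c ^+ (n - k) * c ^+ k by rewrite -exprD subnK.
by rewrite mulfK// expf_neq0.
Unshelve. all: by end_near. Qed.

End ExpLimit.

(** * Convergence in total variation from convergence of mixed derivatives *)

Section Scheffe.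
Context {R : realType} {d : nat}.
Local Notation V := 'rV[R]_d.
Local Notation zeroV := (const_mx 0 : V).
Local Open Scope ereal_scope.

Lemma lt_limn_einf (u : (\bar R)^nat) c : c < limn_einf u -> \forall n \near \oo, c < u n.
Proof.
rewrite limn_einf_lim => cu.
have := @cvg_einfs_sup R u; move=> /cvg_lim eu; rewrite eu// in cu.
have [_ [N _ <-] cN] := ereal_sup_gt cu.
exists N => // n /= Nn; apply: lt_le_trans cN _.
by apply: ereal_inf_lbound; exists n.
Qed.

Lemma measurable_box (a b : R) :
  measurable ([set z : V | forall j, (a < z ord0 j <= b)%R] : set (borelRV R d)).
Proof.
have -> : [set z : V | forall j, (a < z ord0 j <= b)%R] =
    \bigcap_(j in [set: 'I_d]) ((fun z : borelRV R d => (z : V) ord0 j) @^-1` `]a, b]%classic).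
  by apply/seteqP; split => [z h j _|z h j]; [have := h j|have := h j I]; rewrite /= in_itv.
apply: fin_bigcap_measurable; first exact: finite_finset.
by move=> j _; rewrite -[X in measurable X]setTI; apply: measurable_coord.
Qed.

(** The boxes with sides []- (n + 1), - 1 / (n + 1)]] increase to the open negative orthant. A box
    bounded away from its boundary is needed because the derivatives exist only inside. *)
Lemma orthant_box_cvg (G : probability (borelRV R d) R) (e : R) : (0 < e)%R ->
  G [set z : V | vlt z zeroV] = 1 ->
  exists a b : R, [/\ (a <= b)%R, (b < 0)%R &
    1 - e%:E <= G [set z : V | forall j, (a < z ord0 j <= b)%R]].
Proof.
move=> e0 GO.
pose B (n : nat) : set V := [set z | forall j, (- n.+1%:R < z ord0 j <= - n.+1%:R^-1)%R].
have mB n : measurable (B n : set (borelRV R d)) by exact: measurable_box.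
have BO : \bigcup_n B n = [set z : V | vlt z zeroV].
  apply/seteqP; split => z.
    move=> [n _ Bz] i; have /andP[_ h] := Bz i; rewrite mxE.
    by apply: le_lt_trans h _; rewrite oppr_lt0 invr_gt0.
  move=> z0.
  have : \forall n \near \oo, forall j, (- n.+1%:R < z ord0 j <= - n.+1%:R^-1)%R.
    apply: (@filter_forall _ _ (fun j n => (- n.+1%:R < z ord0 j <= - n.+1%:R^-1)%R) \oo) => j.
    have zj : (0 < - z ord0 j)%R by rewrite oppr_gt0; have := z0 j; rewrite mxE.
    near=> n; apply/andP; split.
      rewrite ltrNl; apply: (@lt_le_trans _ _ n%:R); last by rewrite ler_nat.
      by near: n; exact: nbhs_infty_gtr.
    rewrite lerNr; apply: ltW; near: n.
    exact: near_infty_natSinv_lt (PosNum zj).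
  by move=> [n _ /(_ n (leqnn n)) h]; exists n.
have cB : G \o B @ \oo --> G (\bigcup_n B n).
  apply: nondecreasing_cvg_mu => //; first exact: bigcupT_measurable.
  move=> m n mn; apply/subsetPset => z h j; have /andP[h1 h2] := h j.
  apply/andP; split; first by apply: le_lt_trans h1; rewrite lerN2 ler_nat.
  by apply: le_trans h2 _; rewrite lerN2 lef_pV2 ?posrE// ler_nat.
rewrite BO GO in cB.
have /fine_cvgP[_ /cvgrPdist_le /(_ e e0)[N _ /(_ N (leqnn N)) /= h]] := cB.
exists (- N.+1%:R)%R, (- N.+1%:R^-1)%R; split.
- by rewrite lerN2 (@le_trans _ _ 1%R) ?invf_le1 ?ler1n.
- by rewrite oppr_lt0 invr_gt0.
rewrite -/(B N) -(@fineK _ (G (B N))) ?fin_num_measure// -EFinB lee_fin.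
by move: h; rewrite ler_distl => /andP[_]; rewrite -lerBlDr.
Unshelve. all: by end_near. Qed.

Lemma cvge0_le (u : (\bar R)^nat) : (forall n, 0 <= u n) ->
  (forall e : R, (0 < e)%R -> \forall n \near \oo, u n <= e%:E) -> u @ \oo --> 0.
Proof.
move=> u0 ue.
have fin (e : R) n : u n <= e%:E -> u n \is a fin_num.
  by move=> un; rewrite ge0_fin_numE// (le_lt_trans un)// ltry.
apply/fine_cvgP; split; first by apply: filterS (ue 1%R ltr01) => n /fin.
apply/cvgrPdist_le => e e0; apply: filterS (ue e e0) => n un /=.
by rewrite sub0r normrN ger0_norm ?fine_ge0// -lee_fin fineK//; exact: fin un.
Qed.

Lemma scheffe_partial (s : seq 'I_d) (mu : nat -> probability (borelRV R d) R)
    (G : probability (borelRV R d) R) :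
  uniq s -> (forall j, j \in s) ->
  G [set z : V | vlt z zeroV] = 1 ->
  (forall x, vlt x zeroV -> has_partial s (df G) x) ->
  (forall x, vlt x zeroV -> \forall n \near \oo, has_partial s (df (mu n)) x) ->
  (forall x, vlt x zeroV ->
     partial s (df (mu n)) x @[n --> \oo] --> partial s (df G) x) ->
  ereal_sup [set `|mu n A - G A| | A in @measurable _ (borelRV R d)] @[n --> \oo] --> 0.
Proof.
move=> us js GO hG hmu cvmu.
apply: cvge0_le => [n|e].
  by apply: ereal_sup_ubound; exists set0 => //; rewrite !measure0 subee// abse0.
move=> e0; have e20 : (0 < e / 2)%R by rewrite divr_gt0.
have [a [b [ab b0 GB]]] := orthant_box_cvg e20 GO.
pose D : set R := `[a, b]%classic.
have mD : measurable D by exact: measurable_itv.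
(* All coordinates are integrated, so the base point serves only as a negative starting point. *)
pose x0 : V := const_mx b.
have x00 : vlt x0 zeroV by move=> i; rewrite !mxE.
pose g := density G s.
have mg : measurable_fun [set: borelRV R d] g by exact: measurable_density.
have g0 x : 0 <= g x by exact: density_ge0.
(* The increment of the distribution function of [G] over the box is the mass of the box, and it is
   at most the integral of the density. *)
have Lg : 1 - (e / 2)%:E <= intn D s g x0.
  apply: (le_trans GB); apply: le_trans (bdiff_le_intn ab b0 us hG mg g0 _ x00); last first.
    by move=> y y0; rewrite /g density_partial//; exact: hG.
  rewrite bdiff_df//.
  have -> : [set z : V | forall j,
        if j \in s then (a < z ord0 j <= b)%R else (z ord0 j <= x0 ord0 j)%R] =
      [set z : V | forall j, (a < z ord0 j <= b)%R].
    by apply/seteqP; split => z h j; have := h j; rewrite js.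
  by rewrite fineK// fin_num_measure//; exact: measurable_box.
pose m n x := mine (density (mu n) s x) (g x).
have mm n : measurable_fun [set: borelRV R d] (m n).
  by apply: measurable_mine => //; exact: measurable_density.
have m0 n x : 0 <= m n x by rewrite le_min g0 density_ge0.
(* By Fatou it is enough that the lower limit of [m n] is at least [g] on the box, where both
   densities are mixed derivatives and these converge. *)
have Lm : 1 - (e / 2)%:E <= limn_einf (fun n => intn D s (m n) x0).
  apply: (le_trans Lg); apply: le_trans (fatou_intn mD s x0 mm m0).
  apply: le_intn => //.
  - exact: measurable_fun_limn_einf.
  - by move=> x; exact: limn_einf_ge0.
  move=> x xD; have x_lt0 : vlt x zeroV.
    move=> j; rewrite mxE; have := xD j (js j); rewrite /D/= in_itv/= => /andP[_ xb].
    exact: le_lt_trans b0.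
  have E : (fun n => (partial s (df (mu n)) x)%:E) @ \oo --> (partial s (df G) x)%:E.
    by apply/fine_cvgP; split; [exact: nearW|exact: cvmu].
  have gE : g x = (partial s (df G) x)%:E by rewrite /g density_partial//; exact: hG.
  rewrite (@near_eq_limn_einf _ _ (fun n => mine (partial s (df (mu n)) x)%:E (g x))); last first.
    apply: filterS (hmu x x_lt0) => n hn; rewrite /m density_partial//.
  rewrite gE; apply/lee_addgt0Pr => e1 e10.
  rewrite -leeBlDr// -[leLHS]limn_einf_cst; apply: near_le_limn_einf.
  have /cvgrPdist_le /(_ e1 e10) := cvmu x x_lt0; apply: filterS => n.
  rewrite ler_distl => /andP[_ h]; rewrite -EFin_min -EFinB lee_fin le_min.
  by rewrite lerBlDr h/= lerBlDr lerDl ltW.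
have : \forall n \near \oo, 1 - e%:E < intn D s (m n) x0.
  apply: lt_limn_einf; apply: lt_le_trans Lm; rewrite -!EFinB lte_fin ltrD2l ltrN2.
  by rewrite ltr_pdivrMr// ltr_pMr// ltr1n.
apply: filterS => n hn; apply: ge_ereal_sup => _ [A mA <-].
have mAc : measurable (~` A : set (borelRV R d)) by exact: measurableC.
have mr (B : set (borelRV R d)) : measurable B -> measurable_fun setT (m n \_ B).
  by move=> mB; apply/(measurable_restrictT _ mB); exact: measurable_funTS.
have r0 (B : set (borelRV R d)) x : 0 <= (m n \_ B) x.
  by apply: erestrict_ge0 => *; exact: m0.
have split_m : intn D s (m n) x0 = intn D s (m n \_ A) x0 + intn D s (m n \_ (~` A)) x0.
  transitivity (intn D s (fun x => (m n \_ A) x + (m n \_ (~` A)) x) x0); last first.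
    by rewrite (intnD mD)//; exact: mr.
  congr (intn _ _ _ _); apply/funext => x.
  by rewrite /patch in_setC; case: (x \in A); rewrite /= ?adde0 ?add0e.
have bound (nu : probability (borelRV R d) R) (B : set (borelRV R d)) : measurable B ->
    (forall x, m n x <= density nu s x) -> intn D s (m n \_ B) x0 <= nu B.
  move=> mB mnu; apply: le_trans (intn_density_borel nu mD x0 mB us js).
  apply: le_intn => //; first exact: mr.
  - by apply/(measurable_restrictT _ mB); apply: measurable_funTS; exact: measurable_density.
  - by move=> x; apply: erestrict_ge0 => *; exact: density_ge0.
  by move=> x _; rewrite /patch; case: ifP.
have mmu x : m n x <= density (mu n) s x by rewrite ge_min lexx.
have mG x : m n x <= density G s x by rewrite ge_min lexx orbT.
(* With [u] and [v] the integrals of [m n] over [A] and its complement, both probabilities of [A]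
   lie in [[u, 1 - v]], an interval shorter than [e]. *)
move: hn; rewrite split_m; move: (bound _ A mA mmu) (bound _ A mA mG)
  (bound _ _ mAc mmu) (bound _ _ mAc mG).
have := intn_ge0 D s (r0 A) x0; have := intn_ge0 D s (r0 (~` A)) x0.
rewrite !probability_setC//.
rewrite -(@fineK _ (mu n A)) ?fin_num_measure// -(@fineK _ (G A)) ?fin_num_measure//.
move: (fine _) (fine _) => p q.
case: (intn D s (m n \_ (~` A)) x0) => [v| |] //; case: (intn D s (m n \_ A) x0) => [u| |] //.
rewrite -!EFinB -!EFinD !lee_fin lte_fin => _ _ h1 h2 h3 h4 h5.
by rewrite ler_norml; apply/andP; split; lra.
Qed.

End Scheffe.

(** * Partial derivatives and total mass on the open negative orthant *)

Section Orthant.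
Context {R : realType} {d : nat}.
Local Notation V := 'rV[R]_d.
Local Notation zeroV := (const_mx 0 : V).
Implicit Types (x : V) (s r : seq 'I_d) (f g : V -> R).

Lemma vlt_line x i : vlt x zeroV -> \forall t \near (0 : R), vlt (x + t *: dir i) zeroV.
Proof.
move=> x0; have xi : 0 < - x 0 i by rewrite oppr_gt0; have := x0 i; rewrite mxE.
exists (- x 0 i) => //= t; rewrite /ball_/= sub0r normrN => /ltr_normlW tx j.
rewrite coord_shift mxE; have [->|_] := eqVneq j i.
  by rewrite -ltrBrDl sub0r.
by rewrite addr0; have := x0 j; rewrite mxE.
Qed.

(** The orthant is open along coordinate lines. This serves for the distribution function of [G],
    known by its formula only at nonpositive points. *)
Lemma eq_partial_orthant f g s x : (forall y, vlt y zeroV -> f y = g y) ->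
  vlt x zeroV -> has_partial s f x -> has_partial s g x /\ partial s g x = partial s f x.
Proof.
move=> fg; elim: s x => [|i s IH] x x0 /=; first by rewrite fg.
move=> [nx dx]; have [dg Dg] : is_derive x (dir i) (partial s g) ('D_(dir i) (partial s f) x).
  apply: (@near_line_is_derive _ _ (partial s f)); last by split.
  by apply: filterS2 nx (vlt_line i x0) => t hp /IH /(_ hp)[].
by split=> //; split=> //; apply: filterS2 nx (vlt_line i x0) => t hp /IH /(_ hp)[].
Qed.

Lemma partialN f s x : has_partial s f x ->
  has_partial s (fun y => - f y) x /\ partial s (fun y => - f y) x = - partial s f x.
Proof.
elim: s x => [//|i s IH] x /= [nx dx].
have [dg Dg] : is_derive x (dir i) (partial s (fun y => - f y)) (- 'D_(dir i) (partial s f) x).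
  apply: (@near_line_is_derive _ _ (- partial s f)).
    by apply: filterS nx => t /IH[].
  by apply: is_deriveN; split.
by split=> //; split=> //; apply: filterS nx => t /IH[].
Qed.

Lemma has_partial_suffix r s f x : has_partial (r ++ s) f x -> has_partial s f x.
Proof. by elim: r => //= i r IH /has_partial_near. Qed.

Lemma has_partial_size_le f x s : (0 < d)%N ->
  (forall t : d.-tuple 'I_d, has_partial t f x) -> (size s <= d)%N -> has_partial s f x.
Proof.
move=> d0 h sd; pose i0 := Ordinal d0.
(* The padding goes in front: those derivatives are taken after the ones in [s], whose existence
   they presuppose. *)
have st : size (nseq (d - size s) i0 ++ s) == d by rewrite size_cat size_nseq subnK.
by apply: (@has_partial_suffix (nseq (d - size s) i0)); exact: (h (Tuple st)).
Qed.

Lemma orthant_full (G : probability (borelRV R d) R) (c : R) :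
  (forall n : nat, G [set z | vle z (const_mx (- n.+1%:R^-1))] = (expR (- (n.+1%:R^-1 * c)))%:E) ->
  G [set z : V | vlt z zeroV] = 1%E.
Proof.
move=> hG.
have mO : measurable ([set z : V | vlt z zeroV] : set (borelRV R d)).
  have -> : [set z : V | vlt z zeroV] = \bigcap_(j in [set: 'I_d])
      ((fun z : borelRV R d => (z : V) ord0 j) @^-1` `]-oo, 0[%classic).
    by apply/seteqP; split => [z h j _|z h j]; [have := h j|have := h j I]; rewrite mxE /= in_itv.
  apply: fin_bigcap_measurable; first exact: finite_finset.
  by move=> j _; rewrite -[X in measurable X]setTI; apply: measurable_coord.
apply/eqP; rewrite eq_le probability_le1//= -(@fineK _ (G _)) ?fin_num_measure// lee_fin.
have L : (fun n : nat => expR (- (n.+1%:R^-1 * c))) @ \oo --> (1 : R).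
  have E : expR (- (0 * c)) = 1 by rewrite mul0r oppr0 expR0.
  rewrite -[X in _ --> X]E; apply: continuous_cvg; first exact: continuous_expR.
  by apply: cvgN; apply: cvgM; [exact: cvg_harmonic|exact: cvg_cst].
apply: (cvgr_to_le L); apply: nearW => n; rewrite -lee_fin fineK ?fin_num_measure// -hG.
apply: le_measure; rewrite ?inE//.
  by rewrite -cell_nil; exact: measurable_cell.
move=> z zn i; rewrite mxE; have := zn i; rewrite mxE => /le_lt_trans; apply.
by rewrite oppr_lt0 invr_gt0.
Qed.

End Orthant.

(** * The distribution function of the normalised maxima *)

Section Maxima.
Context {R : realType} {d : nat}.
Local Notation V := 'rV[R]_d.
Context dT (T : measurableType dT) (P : probability T R) (U : nat -> {RV P >-> borelRV R d}).

Definition normalized_max n (t : T) : borelRV R d :=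
  n%:R *: (cmax (fun i => U i t : V) n - const_mx 1).

Lemma measurable_normalized_max n : measurable_fun setT (normalized_max n).
Proof.
apply: measurable_rV => j.
have mU i : measurable_fun setT (fun t => (U i t : V) 0 j).
  by apply: (measurableT_comp (measurable_coord j)); exact: measurable_funPT.
under eq_fun do rewrite !mxE.
apply: measurable_funM => //; apply: measurable_funB => //.
under eq_fun do rewrite -(big_mkord xpredT (fun i => (U i _ : V) 0 j)).
elim: (index_iota 0 n) => [|i l IH].
  by under eq_fun do rewrite big_nil; exact: mU.
under eq_fun do rewrite big_cons.
exact: measurable_maxr.
Qed.

Lemma vle_normalized_max n t (x : V) : (0 < n)%N ->
  vle (normalized_max n t) x <->
  forall i, (i < n)%N -> vle (U i t : V) (const_mx 1 + n%:R^-1 *: x).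
Proof.
move=> n0; have nR : (0 : R) < n%:R by rewrite ltr0n.
have E (y z : R) : (n%:R * (y - 1) <= z) = (y <= 1 + n%:R^-1 * z).
  by rewrite mulrC -ler_pdivlMr// lerBlDl mulrC.
split=> [h i ni j|h j].
  have := h j; rewrite !mxE E => /bigmax_leP[_ /(_ (Ordinal ni) isT)].
  exact.
rewrite !mxE E; apply/bigmax_leP; split=> [|i _].
  (* The default value of the maximum is the observation of index 0, itself among the first [n]
     since [n] is positive. *)
  by have := h 0%N n0 j; rewrite !mxE.
by have := h i (ltn_ord i) j; rewrite !mxE.
Qed.

Lemma df_normalized_max (C : V -> R) n x : mutually_independent U ->
  (forall i, is_df (U i) C) -> (0 < n)%N ->
  P [set t | vle (normalized_max n t) x] = ((C (const_mx 1 + n%:R^-1 *: x)) ^+ n)%:E.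
Proof.
move=> hU hUC n0; pose y : V := const_mx 1 + n%:R^-1 *: x.
pose J := [fset i in iota 0 n]%fset.
have mA i : i \in J -> measurable ([set z | vle z y] : set (borelRV R d)).
  by move=> _; rewrite -cell_nil; exact: measurable_cell.
have -> : [set t | vle (normalized_max n t) x] =
    \bigcap_(i in [set` J]) (U i @^-1` [set z | vle z y]).
  apply/seteqP; split => t.
    move=> /(vle_normalized_max _ _ n0) h i /=; rewrite in_fset /= mem_iota => /andP[_].
    exact: h.
  move=> h; apply/(vle_normalized_max _ _ n0) => i ni; apply: h => /=.
  by rewrite in_fset /= mem_iota.
rewrite (hU J (fun=> [set z | vle z y]) mA).
rewrite (eq_bigr (fun=> (C y)%:E)); last by move=> i _; exact: hUC.
have -> (l : seq nat) : (\prod_(i <- l) (C y)%:E)%E = (C y ^+ size l)%:E.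
  by elim: l => [|i l IH]; rewrite ?big_nil// big_cons IH exprS EFinM.
have -> : size J = n; last by [].
  rewrite -(size_iota 0 n); apply: perm_size.
  by apply: uniq_perm; rewrite ?fset_uniq ?iota_uniq// => i; rewrite in_fset.
Qed.

End Maxima.

(** * The limit of the rescaled copula near its upper corner *)

Section TailLimit.
Context {R : realType} {d : nat}.
Local Notation V := 'rV[R]_d.

(** At [u = 1 + x / n] homogeneity gives [N (1 - u) = N x / n], and likewise for [nrm]; multiplying
    by [n] therefore leaves [- N x] and a remainder that vanishes. *)
Lemma cvg_normalized_tail (C N nrm : V -> R) x : is_norm N -> is_norm nrm ->
  (fun u : V => C u - (1 - N (const_mx 1 - u)))
     =o_ (within unit_cube (nbhs (const_mx 1 : V))) (fun u : V => nrm (const_mx 1 - u)) ->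
  vlt x (const_mx 0) ->
  n%:R * (C (const_mx 1 + n%:R^-1 *: x) - 1) @[n --> \oo] --> - N x.
Proof.
move=> [_ Nh _] [_ nh _] /eqoP ho x0.
have x0' i : x 0 i < 0 by have := x0 i; rewrite mxE.
apply/cvgrPdist_le => e e0.
pose e' := e / (`|nrm x| + 1).
have e'0 : 0 < e' by rewrite divr_gt0// ltr_wpDl.
have {ho} := ho e' e'0; rewrite /within /= => /nbhs_ballP[r /= r0 hr].
have inv0 : (fun n : nat => n%:R^-1 : R) @ \oo --> (0 : R).
  by rewrite -cvg_shiftS; exact: cvg_harmonic.
have small (a : R) : (fun n : nat => n%:R^-1 * a) @ \oo --> (0 : R).
  by rewrite -[X in _ --> X](mul0r a); apply: cvgM => //; exact: cvg_cst.
(* The bound [r] puts [u] into the neighbourhood where the remainder is small, the bound 1 keeps it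
   in the unit cube. *)
have near_r : \forall n \near \oo, forall i : 'I_d, `|n%:R^-1 * x 0 i| < Num.min r 1.
  apply: (@filter_forall _ _ (fun i n => `|n%:R^-1 * x 0 i| < Num.min r 1) \oo) => i.
  have m0 : 0 < Num.min r 1 by rewrite lt_min r0 ltr01.
  have /cvgrPdist_lt /(_ _ m0) := small (x 0 i).
  by apply: filterS => n; rewrite sub0r normrN.
have ngt0 : \forall n \near \oo, (0 < n)%N by exact: nbhs_infty_gt.
apply: filterS2 near_r ngt0 => n hx n0.
have nR : (0 : R) < n%:R by rewrite ltr0n.
pose u : V := const_mx 1 + n%:R^-1 *: x.
have uN : const_mx 1 - u = - n%:R^-1 *: x by rewrite /u opprD addNKr scaleNr.
have /= := hr u; rewrite uN Nh nh normrN [ `|n%:R^-1|]gtr0_norm ?invr_gt0//; set D := C u - _.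
have -> : - N x - n%:R * (C (const_mx 1 + n%:R^-1 *: x) - 1) = - (n%:R * D).
  rewrite -/u /D. field; exact: lt0r_neq0.
move=> h; rewrite normrN normrM gtr0_norm//.
have {}h : `|D| <= e' * `|n%:R^-1 * nrm x|.
  apply: h.
    split=> // i j; rewrite ord1 /ball/= !mxE opprD addNKr normrN.
    by have := hx j; rewrite lt_min => /andP[].
  split=> j; rewrite !mxE; have := hx j; rewrite lt_min => /andP[_].
    by rewrite ltr_norml => /andP[h _]; lra.
  by move=> _; rewrite gerDl pmulr_rle0 ?invr_gt0// ltW.
rewrite normrM [ `|n%:R^-1|]gtr0_norm ?invr_gt0// mulrCA in h.
rewrite mulrC -ler_pdivlMr// mulrC; apply: (le_trans h).
rewrite ler_wpM2l ?invr_ge0 ?ler0n//.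
by rewrite /e' mulrAC ler_pdivrMr ?ltr_wpDl// ler_wpM2l ?lerDl// ltW.
Qed.

End TailLimit.

(** * Application to the maxima of independent vectors with distribution function [C] *)

Theorem theorem2p4 (R : realType) (d : nat) (hd : (2 <= d)%N)
  (normD : 'rV[R]_d -> R) (hD : is_Dnorm normD)
  (hDpartial : forall (s : d.-tuple 'I_d) (x : 'rV[R]_d),
     vlt x (const_mx 0) -> has_partial s normD x)
  (C : 'rV[R]_d -> R) (hC : is_copula C)
  (nrm : 'rV[R]_d -> R) (hnrm : is_norm nrm)
  (hi : (fun u : 'rV[R]_d => C u - (1 - normD (const_mx 1 - u)))
     =o_ (within unit_cube (nbhs (const_mx 1 : 'rV[R]_d)))
     (fun u : 'rV[R]_d => nrm (const_mx 1 - u)))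
  (hii : forall (s : seq 'I_d), uniq s -> s != [::] ->
     forall x : 'rV[R]_d, vlt x (const_mx 0) ->
     (\forall n \near \oo, has_partial s
        (fun y : 'rV[R]_d => n%:R * (C (const_mx 1 + n%:R^-1 *: y) - 1)) x) /\
     partial s
       (fun y : 'rV[R]_d => n%:R * (C (const_mx 1 + n%:R^-1 *: y) - 1)) x
       @[n --> \oo] --> partial s (fun y : 'rV[R]_d => - normD y) x)
  (dT : measure_display) (T : measurableType dT) (P : probability T R)
  (U : nat -> {RV P >-> borelRV R d})
  (hU : mutually_independent U) (hUC : forall i, is_df (U i) C)
  (G : probability (borelRV R d) R)
  (hG : forall x : 'rV[R]_d, vle x (const_mx 0) ->
     G [set y | vle y x] = (expR (- normD x))%:E) :
  ereal_sup [set `|P [set t | A (n%:R *: (cmax (fun i => U i t) n - const_mx 1))%R]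
                   - G A|%E
            | A in @measurable _ (borelRV R d)]
    @[n --> \oo] --> 0%E.
Proof.
have [Nnorm _] := hD.
have d0 : (0 < d)%N by exact: leq_trans hd.
pose s := enum 'I_d.
have us : uniq s by exact: enum_uniq.
have js j : j \in s by rewrite mem_enum.
pose mX n := @measurable_normalized_max R d _ T P U n.
pose X n : {RV P >-> borelRV R d} := HB.pack (@normalized_max R d _ T P U n)
  (isMeasurableFun.Build _ _ _ _ (@normalized_max R d _ T P U n) (mX n)).
pose mu n : probability (borelRV R d) R := distribution P (X n).
pose cn n (y : 'rV[R]_d) := n%:R * (C (const_mx 1 + n%:R^-1 *: y) - 1).
(* Since [C (1 + y / n) = 1 + cn n y / n], the power [C ^ n] is the zeroth derivative [powd n 0]
   evaluated at [cn n y]. *)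
have df_mu n : (0 < n)%N -> df (mu n) = fun y => powd n 0 (cn n y).
  move=> n0; apply/funext => y.
  have -> : df (mu n) y = fine (P [set t | vle (normalized_max U n t) y]) by [].
  rewrite (df_normalized_max y hU hUC n0) /= /powd ffactn0 expr0 subn0 !mul1r /cn mulrA.
  by rewrite mulVf ?pnatr_eq0 -?lt0n// mul1r addrCA subrr addr0.
(* Subsequences of [s] have length at most [d], so the derivatives of order [d] cover them. *)
have hall x : vlt x (const_mx 0) -> has_all_partial s (fun y => - normD y) x.
  move=> x0 r rs; apply: (partialN _).1; apply: (has_partial_size_le d0).
    by move=> t; exact: hDpartial.
  by rewrite (leq_trans (size_subseq rs))// size_enum_ord.
have dexp k (u : R) : is_derive u 1 ((fun _ : nat => expR) k) ((fun _ : nat => expR) k.+1 u).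
  exact: is_derive_expR.
have GF y : vlt y (const_mx 0) -> expR (- normD y) = df G y.
  by move=> y0; rewrite /df hG// => i; exact/ltW/y0.
have hpG x : vlt x (const_mx 0) ->
    has_partial s (df G) x /\ partial s (df G) x = partial s (fun y => expR (- normD y)) x.
  move=> x0; have [h _] := faa_di_bruno dexp (hall x x0).
  exact: eq_partial_orthant GF x0 h.
have lim x : vlt x (const_mx 0) ->
    (\forall n \near \oo, has_partial s (df (mu n)) x) /\
    partial s (df (mu n)) x @[n --> \oo] --> partial s (df G) x.
  move=> x0; rewrite (hpG x x0).2.
  have c0 : cn n x @[n --> \oo] --> - normD x by exact: (cvg_normalized_tail Nnorm hnrm hi x0).
  have [||h1 h2] := @cvg_partial_comp R d (@powd R) (fun _ => expR) cn (fun y => - normD y) s x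
      (@is_derive_powd R) dexp _ (hall x x0).
  - by move=> k; exact: cvg_powd.
  (* The empty block is the pointwise convergence [c0] drawn from (i); nonempty blocks have distinct
     indices and fall under (ii). *)
  - case=> [_|i r rs]; first by split=> //; exact: nearW.
    by have := hii (i :: r) (subseq_uniq rs us) isT x x0.
  have ngt0 : \forall n \near \oo, (0 < n)%N by exact: nbhs_infty_gt.
  split; first by apply: filterS2 h1 ngt0 => n + /df_mu ->.
  apply: cvg_trans h2; apply: near_eq_cvg.
  by apply: filterS ngt0 => n /df_mu ->.
have GO : G [set z | vlt z (const_mx 0)] = 1%E.
  apply: (@orthant_full _ _ _ (normD (const_mx 1))) => n.
  rewrite hG; last by move=> i; rewrite !mxE oppr_le0 invr_ge0.
  have [_ Nh _] := Nnorm.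
  have -> : const_mx (- n.+1%:R^-1) = - n.+1%:R^-1 *: const_mx 1 :> 'rV[R]_d.
    by apply/rowP => i; rewrite !mxE mulr1.
  by rewrite Nh normrN ger0_norm// invr_ge0.
exact: (scheffe_partial us js GO (fun x x0 => (hpG x x0).1) (fun x x0 => (lim x x0).1)
  (fun x x0 => (lim x x0).2)).
Qed.
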